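(* Let $N=\mathbb{Z}^2$ and let $M=\mathrm{Hom}(N,\mathbb{Z})$, identified with $\mathbb{Z}^2$ via the dual basis. Let $\mathcal{R}$ be a set of representatives of all isomorphism classes of $1$-reflexive polygons (respectively, $1$-reflexive loops). Any $Q\in\mathcal{R}$ may be chosen such that $(0,1)\in N$ is a vertex of $Q$ and $(0,1)\in M$ is a vertex of the dual $Q^*$; assume the representatives are so chosen. If $P$ is an $l$-reflexive polygon (respectively, loop) of index $l\ge 2$, then there exists $Q\in\mathcal{R}$ such that $P$ is isomorphic to the image of $Q$ under the map (right multiplication of row vectors) $$\begin{pmatrix}l&i\\0&1\end{pmatrix}$$ for some $0<i<l$ coprime to $l$.
   Context: A nonzero lattice point $x$ is primitive if the segment from $\mathbf{0}$ to $x$ contains no lattice points other than its endpoints. Polygons: a 2-dimensional convex lattice polygon $P$ containing the origin in its interior is $l$-reflexive (of index $l$) if its vertices are primitive and for every edge $F$ the local index $l_F$ equals $l$, where $l_F$ is the positive integer with $F=\{x\in P\mid\langle u_F,x\rangle=l_F\}$ for $u_F\in M$ the primitive outer normal of $F$. Its dual is $P^*=\{y\in M_{\mathbb{Q}}\mid\langle y,x\rangle\le1\ \forall x\in P\}$. Two polygons are isomorphic if an affine lattice isomorphism maps the vertex set of one onto that of the other. Loops: let $x_1,\dots,x_t\in N$ be nonzero lattice points and put $x_0:=x_t$, $x_{t+1}:=x_1$. They are the boundary lattice points of an $l$-reflexive loop $P$ if for each $k=1,\dots,t$: (1) $x_{k+1}-x_k$ is primitive; (2) the determinant of the $2\times2$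 matrix formed by $x_k,x_{k+1}$ equals $\pm l$; (3) if $x_k$ is a vertex (i.e. $x_k\notin\mathrm{conv}\{x_{k-1},x_{k+1}\}$) then $x_k$ is primitive. For each $k$ let $u_k\in M$ be the primitive outer normal to $\mathrm{conv}\{x_k,x_{k+1}\}$, i.e. the unique primitive point with $\langle u_k,x_k\rangle=\langle u_k,x_{k+1}\rangle=l$. The dual $l$-reflexive loop $lP^*$ (so $Q^*$ when $l=1$) is the loop in $M$ whose boundary lattice points are the points of $\bigcup_{k=1}^t\mathrm{conv}\{u_k,u_{k+1}\}\cap M$ (indices cyclic), traversed successively from $u_k$ to $u_{k+1}$, immediate repetitions omitted. Two loops are isomorphic if a lattice isomorphism maps the cyclic sequence of boundary lattice points of one onto that of the other. The image of a loop under a linear map is the polygonal loop through the images of its vertices in the same cyclic order.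
   Formalization: The single point of a one-point loop is counted as a vertex; without this, loops such as (1,0),(0,1) back and forth have a one-point dual with no vertex, so no representative could be chosen with (0,1) a vertex of the dual. *)

(* Defs.v *)
From HB Require Import structures.
From mathcomp Require Import all_boot all_order all_algebra.
From mathcomp Require Import boolp classical_sets ring lra.

Set Implicit Arguments.
Unset Strict Implicit.
Unset Printing Implicit Defensive.
Import Order.TTheory GRing.Theory Num.Theory.
Local Open Scope classical_set_scope.
Local Open Scope ring_scope.

(* N = Z^2 and its dual M (in the dual basis) are both 'rV[int]_2; N_Q and
   M_Q are 'rV[rat]_2.  Linear maps act on row vectors from the right. *)

Definition toQ (x : 'rV[int]_2) : 'rV[rat]_2 := map_mx intr x.

Definition row2 (T : pzRingType) (a b : T) : 'rV[T]_2 :=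
  row_mx (a%:M : 'M_1) (b%:M : 'M_1).

Definition mx22 (T : pzRingType) (a b c d : T) : 'M[T]_2 :=
  block_mx (a%:M : 'M_1) (b%:M : 'M_1) (c%:M : 'M_1) (d%:M : 'M_1).

Definition pairing (T : pzRingType) (u x : 'rV[T]_2) : T := (u *m x^T) 0 0.

Definition det2 (x y : 'rV[int]_2) : int := \det (col_mx x y : 'M[int]_2).

Definition hull (s : seq 'rV[int]_2) : set 'rV[rat]_2 :=
  [set x : 'rV[rat]_2 | exists c : 'I_(size s) -> rat,
     [/\ forall i, 0 <= c i, \sum_i c i = 1
       & x = \sum_i c i *: toQ s`_i]].

Lemma hull2P a b z : hull [:: a; b] z <->
  exists2 t : rat, 0 <= t <= 1 & z = toQ a + t *: (toQ b - toQ a).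
Proof.
split=> [[c [c0 c1 ->]]|[t t01 ->]].
  move: c1; rewrite !big_ord_recl !big_ord0 !addr0 /= => c1.
  exists (c (lift ord0 ord0)).
    by have := c0 ord0; have := c0 (lift ord0 ord0); move=> *; lra.
  apply/rowP=> j; rewrite !mxE.
  have -> : c ord0 = 1 - c (lift ord0 ord0) by lra.
  ring.
exists (fun i => if val i == 0%N then 1 - t else t); split.
- by case=> [[|k]] /= ?; lra.
- rewrite !big_ord_recl !big_ord0 /=; ring.
- rewrite !big_ord_recl !big_ord0 /=; apply/rowP=> j; rewrite !mxE; ring.
Qed.

Definition primitive (x : 'rV[int]_2) : Prop :=
  x <> 0 /\ forall y : 'rV[int]_2, hull [:: 0; x] (toQ y) -> y = 0 \/ y = x.

(* Exactly one element of C in each class of the equivalence relation E. *)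
Definition representatives (X : Type) (C : set X) (E : X -> X -> Prop)
    (S : set X) : Prop :=
  [/\ forall Q, S Q -> C Q,
      forall P, C P -> exists2 Q, S Q & E P Q
    & forall Q Q', S Q -> S Q' -> E Q Q' -> Q = Q'].

Section Polygons.
Implicit Types (P F : set 'rV[rat]_2).

Definition lattice_polytope P : Prop := exists s, P = hull s.

Definition origin_interior P : Prop :=
  exists2 e : rat, 0 < e &
    forall x : 'rV[rat]_2, (forall j, `|x 0 j| <= e) -> P x.

(* The extreme points. *)
Definition vertices P : set 'rV[rat]_2 :=
  [set v | P v /\ forall x y (t : rat), P x -> P y -> 0 < t < 1 ->
     v = t *: x + (1 - t) *: y -> x = v /\ y = v].

Definition face_in_direction P (u : 'rV[rat]_2) F : Prop :=
  exists2 c : rat, (forall x, P x -> pairing u x <= c)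
                 & F = [set x : 'rV[rat]_2 | P x /\ pairing u x = c].

(* Intended for full-dimensional P: there a face cut out by a nonzero u has
   dimension at most 1. *)
Definition edge P F : Prop :=
  (exists2 u : 'rV[rat]_2, u <> 0 & face_in_direction P u F) /\
  (exists x y, [/\ F x, F y & x <> y]).

Definition outer_normal P F (u : 'rV[int]_2) : Prop :=
  primitive u /\ face_in_direction P (toQ u) F.

Definition local_index P F (l : nat) : Prop :=
  (0 < l)%N /\
  exists2 u, outer_normal P F u
           & F = [set x : 'rV[rat]_2 | P x /\ pairing (toQ u) x = l%:R].

(* Having the origin in its interior makes the polytope 2-dimensional. *)
Definition reflexive_polygon (l : nat) P : Prop :=
  [/\ lattice_polytope P, origin_interior P,
      forall v : 'rV[int]_2, vertices P (toQ v) -> primitive v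
    & forall F, edge P F -> local_index P F l].

Definition dual_polygon P : set 'rV[rat]_2 :=
  [set y | forall x, P x -> pairing y x <= 1].

Definition polygon_iso P P' : Prop :=
  exists (U : 'M[int]_2) (b : 'rV[int]_2), U \in unitmx /\
    [set x *m map_mx intr U + toQ b | x in vertices P]%classic = vertices P'.

Definition polygon_image (A : 'M[int]_2) P : set 'rV[rat]_2 :=
  [set x *m map_mx intr A | x in P]%classic.

Definition normalized_polygon P : Prop :=
  vertices P (toQ (row2 0 1)) /\ vertices (dual_polygon P) (toQ (row2 0 1)).

End Polygons.

(* A loop is given by the list of its boundary lattice points, to be read
   cyclically; two lists differing by a rotation describe the same loop. *)
Section Loops.
Implicit Types (s xs ys us : seq 'rV[int]_2).

Definition cnth s (k : nat) : 'rV[int]_2 := s`_(k %% size s).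

(* The point of a one-point loop counts as a vertex.  No one-point loop is
   reflexive (its step is 0), but the dual of a reflexive loop lying on a
   line, e.g. (1,0), (1,1), consists of a single point. *)
Definition is_vertex s (k : nat) : Prop :=
  size s = 1%N \/
  ~ hull [:: cnth s (k + (size s).-1); cnth s k.+1] (toQ (cnth s k)).

Definition loop_vertices s : seq 'rV[int]_2 :=
  [seq cnth s k | k <- iota 0 (size s) & `[< is_vertex s k >]].

Definition reflexive_loop (l : nat) xs : Prop :=
  [/\ (0 < size xs)%N, (forall x, x \in xs -> x <> 0) &
      forall k, (k < size xs)%N ->
        [/\ primitive (cnth xs k.+1 - cnth xs k),
            `|det2 (cnth xs k) (cnth xs k.+1)|%N = l
          & is_vertex xs k -> primitive (cnth xs k)]].

(* The lattice points of the segment from a to b, endpoints included, in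
   order: the primitive step is the difference divided by the gcd of its
   coordinates (see mem_lattice_segment). *)
Definition lattice_segment (a b : 'rV[int]_2) : seq 'rV[int]_2 :=
  let e := b - a in
  let g := gcdn `|e 0 0| `|e 0 1| in
  let d : 'rV[int]_2 := \row_j divz (e 0 j) g%:Z in
  [seq a + d *+ j | j <- iota 0 g.+1].

Lemma mem_lattice_segment a b y :
  (y \in lattice_segment a b) <-> hull [:: a; b] (toQ y).
Proof.
rewrite hull2P /lattice_segment.
set g := gcdn _ _; set d := (\row_j _)%R.
have dvd j : ((b - a) 0 j) \in dvdz g%:Z.
  rewrite dvdzE /= .
  have [->|->] : j = 0 \/ j = 1.
    by case: j => -[|[|//]] p; [left|right]; apply/val_inj.
    exact: dvdn_gcdl.
  exact: dvdn_gcdr.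
have ba : b - a = d *+ g.
  by apply/rowP=> j; rewrite [RHS]mulmxnE [in RHS]mxE -mulr_natr natz divzK //; exact: dvd.
have baQ j : (b 0 j)%:~R - (a 0 j)%:~R = (d 0 j)%:~R * g%:R :> rat.
  have := congr1 (fun m : 'rV_2 => (m 0 j)%:~R : rat) ba.
  rewrite [in RHS]mulmxnE !mxE rmorphB /= rmorphMn /= => ->.
  by rewrite mulr_natr.
clearbody d.
split=> [/mapP[j]|[t t01 yE]].
  rewrite mem_iota add0n /= ltnS => jg ->.
  have [g0|g0] := posnP g.
    exists 0; first by lra.
    by move: jg; rewrite g0 leqn0 => /eqP->; rewrite mulr0n addr0 scale0r addr0.
  have gQ : (0 : rat) < g%:R by rewrite ltr0n.
  exists (j%:R / g%:R).
    by rewrite divr_ge0 ?ler0n //= ler_pdivrMr // mul1r ler_nat.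
  apply/rowP=> k; have bk := baQ k; rewrite !mxE mulmxnE rmorphD /= rmorphMn /= bk.
  have gn : g%:R != 0 :> rat by exact: lt0r_neq0.
  by rewrite mulrCA divfK // mulr_natr.
have yj j : (y 0 j)%:~R = (a 0 j)%:~R + t * ((d 0 j)%:~R * g%:R) :> rat.
  by have := congr1 (fun m : 'rV_2 => m 0 j) yE; rewrite !mxE baQ.
have [g0|g0] := posnP g.
  apply/mapP; exists 0%N => //; rewrite mulr0n addr0.
  apply/rowP=> j; apply/eqP; rewrite -(eqr_int rat) yj g0; apply/eqP; ring.
have [u [v]] : exists u v : int, u * d 0 0 + v * d 0 1 = 1.
  have [u [v uv]] := Bezoutz ((b - a) 0 0) ((b - a) 0 1).
  exists u, v; have gz : g%:Z != 0 by rewrite eqz_nat -lt0n.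
  apply: (mulIf gz); rewrite mul1r.
  have e j : (b - a) 0 j = d 0 j * g%:Z.
    by rewrite ba mulmxnE -mulr_natr natz.
  have : gcdz ((b - a) 0 0) ((b - a) 0 1) = g%:Z by [].
  by rewrite -uv !e => h; rewrite -[RHS]h; ring.
move=> uv.
have uvQ : u%:~R * (d 0 0)%:~R + v%:~R * (d 0 1)%:~R = 1 :> rat.
  by rewrite -!rmorphM -rmorphD uv.
pose m : int := u * (y 0 0 - a 0 0) + v * (y 0 1 - a 0 1).
have mE : m%:~R = t * g%:R :> rat.
  rewrite /m rmorphD !rmorphM !rmorphB /= !yj.
  by transitivity (t * g%:R * (u%:~R * (d 0 0)%:~R + v%:~R * (d 0 1)%:~R));
    [ring | rewrite uvQ mulr1].
have gQ : (0 : rat) < g%:R by rewrite ltr0n.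
have m0 : 0 <= m by rewrite -(ler_int rat) mE mulr_ge0 //; lra.
have mg : m <= g%:Z.
  by rewrite -(ler_int rat) mE -[X in _ <= X]mul1r ler_wpM2r //; lra.
apply/mapP; exists `|m|%N.
  by rewrite mem_iota /= add0n ltnS -lez_nat gez0_abs.
apply/rowP=> j; rewrite mxE mulmxnE -mulr_natr natz gez0_abs //.
apply/eqP; rewrite -(eqr_int rat) yj rmorphD rmorphM /= mE; apply/eqP; ring.
Qed.

Fixpoint squeeze s : seq 'rV[int]_2 :=
  if s is x :: s1 then
    if s1 is y :: _ then if x == y then squeeze s1 else x :: squeeze s1 else s
  else [::].

(* Repetitions are also removed across the end of the list, but a constant
   list keeps one point. *)
Definition cyclic_squeeze s : seq 'rV[int]_2 :=
  let r := squeeze s in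
  if (1 < size r)%N && (head 0 r == last 0 r) then behead r else r.

Definition loop_through s : seq 'rV[int]_2 :=
  cyclic_squeeze
    (flatten [seq lattice_segment (cnth s k) (cnth s k.+1)
             | k <- iota 0 (size s)]).

Definition dual_loop (l : nat) xs ys : Prop :=
  exists us,
    [/\ size us = size xs,
        forall k, (k < size xs)%N ->
          [/\ primitive (cnth us k),
              pairing (cnth us k) (cnth xs k) = l%:Z
            & pairing (cnth us k) (cnth xs k.+1) = l%:Z]
      & ys = loop_through us].

Definition loop_iso xs ys : Prop :=
  exists2 U : 'M[int]_2, U \in unitmx &
    exists n, [seq x *m U | x <- xs] = rot n ys.

Definition loop_image (A : 'M[int]_2) xs : seq 'rV[int]_2 :=
  loop_through [seq v *m A | v <- loop_vertices xs].

Definition normalized_loop xs : Prop :=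
  row2 0 1 \in loop_vertices xs /\
  exists2 ys, dual_loop 1 xs ys & row2 0 1 \in loop_vertices ys.

End Loops.

(* Main.v *)
(* The points relevant to an l-reflexive object P all lie in one sublattice Lambda of index l.
   For a loop, Lambda is spanned by two consecutive points: equality of consecutive
   determinants up to sign makes each point an integral combination of the two before it. For
   a polygon, Lambda = {x | l divides <u, x>} for one edge normal u: modulo l all edge normals
   are proportional, because adjacent ones are both orthogonal to a common primitive vertex.
   With respect to Lambda, P is 1-reflexive, so P is the image of a representative Q under
   an integral matrix C with |det C| = l. As (0,1) C is a primitive vertex of P,
   a unimodular change of coordinates brings C to the form (l i; 0 1) with 0 <= i < l. As (0,1)
   is a vertex of Q^*, the line y = 1 carries an edge of Q; its image has primitive direction
   (l,i), that is, normal (-i,l), whence i is coprime to l, and i > 0 since l >= 2. *)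

Require Import Defs.
From mathcomp Require Import all_boot all_order all_algebra.
From mathcomp Require Import boolp classical_sets.
From mathcomp Require Import ring lra zify.

Set Implicit Arguments.
Unset Strict Implicit.
Unset Printing Implicit Defensive.
Import Order.TTheory GRing.Theory Num.Theory.
Local Open Scope ring_scope.

(** * Planar linear algebra and primitive vectors *)

(** A loop offers no convexity: its points may repeat, and it may turn back or wind around the
    origin several times. Vertices are therefore found as lexicographic maxima, and an edge is an
    arithmetic progression, because the two primitive steps at a non-vertex agree. As [loop_image]
    keeps only images of vertices, the whole list has to be rebuilt from its vertices, up to
    rotation. As [normalized_loop] speaks of a vertex of the dual list, such a vertex has to be
    recognised as one of the edge normals.

    For polygons no cyclic order of the vertices is built. Each vertex gets two neighbours whose
    directions generate the tangent cone, so a functional that increases towards neither neighbour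
    is maximal there. This local-to-global principle yields the lattice Lambda, and it also shows
    that the isomorphism with [Q], a priori affine, has no translation part.

    That representatives can be normalised is proved as well: a vertex v and the normal u of an edge
    through v satisfy <u, v> = 1, and one change of basis turns both into (0,1). *)

Lemma ord2P (j : 'I_2) : j = 0 \/ j = 1.
Proof. by case: j => -[|[|//]] p; [left|right]; apply/val_inj. Qed.

Lemma rv2P (T : Type) (x y : 'rV[T]_2) : x 0 0 = y 0 0 -> x 0 1 = y 0 1 -> x = y.
Proof. by move=> e0 e1; apply/rowP=> j; case: (ord2P j) => ->. Qed.

Lemma row2E0 (T : pzRingType) (a b : T) : row2 a b 0 0 = a.
Proof.
transitivity (row2 a b 0 (lshift 1 (0 : 'I_1))); first by congr (row2 _ _ _ _); apply/val_inj.
by apply: etrans (row_mxEl _ _ _ _) _; rewrite mxE eqxx mulr1n.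
Qed.

Lemma row2E1 (T : pzRingType) (a b : T) : row2 a b 0 1 = b.
Proof.
transitivity (row2 a b 0 (rshift 1 (0 : 'I_1))); first by congr (row2 _ _ _ _); apply/val_inj.
by apply: etrans (row_mxEr _ _ _ _) _; rewrite mxE eqxx mulr1n.
Qed.

Lemma mx22E (T : pzRingType) (a b c d : T) :
  (mx22 a b c d 0 0 = a) * (mx22 a b c d 0 1 = b)
  * (mx22 a b c d 1 0 = c) * (mx22 a b c d 1 1 = d).
Proof.
have e i j : mx22 a b c d i j = (if i == 0 then if j == 0 then a else b
                                 else if j == 0 then c else d).
  case: (ord2P i) => ->; case: (ord2P j) => -> /=.
  - transitivity (mx22 a b c d (lshift 1 (0 : 'I_1)) (lshift 1 (0 : 'I_1))).
      by congr (mx22 _ _ _ _ _ _); apply/val_inj.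
    by apply: etrans (block_mxEul _ _ _ _ _ _) _; rewrite mxE eqxx mulr1n.
  - transitivity (mx22 a b c d (lshift 1 (0 : 'I_1)) (rshift 1 (0 : 'I_1))).
      by congr (mx22 _ _ _ _ _ _); apply/val_inj.
    by apply: etrans (block_mxEur _ _ _ _ _ _) _; rewrite mxE eqxx mulr1n.
  - transitivity (mx22 a b c d (rshift 1 (0 : 'I_1)) (lshift 1 (0 : 'I_1))).
      by congr (mx22 _ _ _ _ _ _); apply/val_inj.
    by apply: etrans (block_mxEdl _ _ _ _ _ _) _; rewrite mxE eqxx mulr1n.
  - transitivity (mx22 a b c d (rshift 1 (0 : 'I_1)) (rshift 1 (0 : 'I_1))).
      by congr (mx22 _ _ _ _ _ _); apply/val_inj.
    by apply: etrans (block_mxEdr _ _ _ _ _ _) _; rewrite mxE eqxx mulr1n.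
by rewrite !e.
Qed.

Lemma mulmx2E (T : pzRingType) m (x : 'M[T]_(m, 2)) n (A : 'M[T]_(2, n)) i j :
  (x *m A) i j = x i 0 * A 0 j + x i 1 * A 1 j.
Proof.
rewrite mxE !big_ord_recl big_ord0 addr0.
by congr (x _ _ * A _ _ + x _ _ * A _ _); apply/val_inj.
Qed.

Lemma pairingE (T : pzRingType) (u x : 'rV[T]_2) :
  pairing u x = u 0 0 * x 0 0 + u 0 1 * x 0 1.
Proof. by rewrite /pairing mulmx2E !mxE. Qed.

Lemma det22 (T : comPzRingType) (A : 'M[T]_2) :
  \det A = A 0 0 * A 1 1 - A 0 1 * A 1 0.
Proof.
rewrite (expand_det_row _ 0) !big_ord_recl big_ord0 addr0 /cofactor !det_mx11 !mxE.
rewrite (_ : lift 0 0 = 1 :> 'I_2); last exact/val_inj.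
rewrite (_ : lift 1 0 = 0 :> 'I_2); last exact/val_inj.
by rewrite /= expr0 expr1 mul1r mulN1r mulrN.
Qed.

Definition cross (T : pzRingType) (x y : 'rV[T]_2) : T :=
  x 0 0 * y 0 1 - x 0 1 * y 0 0.

Lemma det2E (x y : 'rV[int]_2) : det2 x y = cross x y.
Proof.
rewrite /det2 det22 /cross.
have e0 j : col_mx x y (0 : 'I_2) j = x 0 j.
  transitivity (col_mx x y (lshift 1 (0 : 'I_1)) j); last exact: col_mxEu.
  by congr (col_mx _ _ _ _); apply/val_inj.
have e1 j : col_mx x y (1 : 'I_2) j = y 0 j.
  transitivity (col_mx x y (rshift 1 (0 : 'I_1)) j); last exact: col_mxEd.
  by congr (col_mx _ _ _ _); apply/val_inj.
by rewrite !e0 !e1.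
Qed.

Definition rows2 (x y : 'rV[int]_2) : 'M[int]_2 :=
  \matrix_(i, j) (if i == 0 then x 0 j else y 0 j).

Lemma det_rows2 x y : \det (rows2 x y) = cross x y.
Proof. by rewrite det22 !mxE. Qed.

Lemma cross_mulmx (T : comPzRingType) (x y : 'rV[T]_2) (A : 'M[T]_2) :
  cross (x *m A) (y *m A) = cross x y * \det A.
Proof. by rewrite det22 /cross !mulmx2E; ring. Qed.

Lemma pairing_mulmx (T : comPzRingType) (u x : 'rV[T]_2) (A : 'M[T]_2) :
  pairing u (x *m A) = pairing (u *m A^T) x.
Proof. by rewrite !pairingE !mulmx2E !mxE; ring. Qed.

Lemma pairing_int (u x : 'rV[int]_2) :
  pairing (toQ u) (toQ x) = (pairing u x)%:~R.
Proof. by rewrite !pairingE !mxE rmorphD !rmorphM. Qed.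

Lemma toQ_inj : injective toQ.
Proof.
by move=> x y /rowP e; apply/rowP=> j; have := e j; rewrite !mxE; apply: intr_inj.
Qed.

Lemma toQ_mulmx x (A : 'M[int]_2) : toQ (x *m A) = toQ x *m map_mx intr A.
Proof. exact: map_mxM. Qed.

Lemma pairingDr (T : pzRingType) (u x y : 'rV[T]_2) :
  pairing u (x + y) = pairing u x + pairing u y.
Proof. by rewrite /pairing linearD mulmxDr mxE. Qed.

Lemma pairingBr (T : pzRingType) (u x y : 'rV[T]_2) :
  pairing u (x - y) = pairing u x - pairing u y.
Proof. by rewrite /pairing linearB mulmxBr !mxE. Qed.

Lemma primitive_coprime (x : 'rV[int]_2) :
  primitive x <-> gcdn `|x 0 0| `|x 0 1| = 1%N.
Proof.
pose g := gcdn `|(x - 0)%R 0 0| `|(x - 0)%R 0 1|.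
have gE : g = gcdn `|x 0 0| `|x 0 1| by rewrite /g subr0.
pose d : 'rV[int]_2 := \row_j divz ((x - 0) 0 j) g%:Z.
have lsE : lattice_segment 0 x = [seq 0 + d *+ j | j <- iota 0 g.+1] by [].
have xd : x = d *+ g.
  apply/rowP=> j; rewrite mulmxnE mxE subr0 -mulr_natr natz divzK //.
  rewrite dvdzE /= gE; case: (ord2P j) => ->; [exact: dvdn_gcdl|exact: dvdn_gcdr].
rewrite -gE; split=> [[x0 px]|g1].
  case: (posnP g) => [g0|gpos]; first by case: x0; rewrite xd g0.
  have : hull [:: 0; x] (toQ d).
    apply/mem_lattice_segment; rewrite lsE; apply/mapP; exists 1%N; rewrite ?add0r //.
    by rewrite mem_iota.
  move/px=> [d0|dx]; first by case: x0; rewrite xd d0 mul0rn.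
  have [j xj] : exists j, x 0 j != 0.
    apply/existsP; rewrite -negb_forall; apply/negP=> /forallP e.
    by case: x0; apply/rowP=> j; rewrite [RHS]mxE; exact/eqP.
  have := congr1 (fun m : 'rV_2 => m 0 j) xd.
  rewrite /= dx mulmxnE -mulr_natr -{1}[x 0 j]mulr1 => /(mulfI xj) /eqP.
  by rewrite natz eqz_nat => /eqP.
split=> [x0|y].
  by move: g1; rewrite gE x0 !mxE.
move/mem_lattice_segment; rewrite lsE g1 => /mapP[j].
rewrite mem_iota add0n; case: j => [|[|//]] _ ->.
  by left; rewrite mulr0n addr0.
by right; rewrite add0r xd g1.
Qed.

(** The Bezout form of primitivity is the working one: the witness [u] is carried along a matrix by
    transposition. *)
Lemma primitiveP (x : 'rV[int]_2) :
  primitive x <-> exists u : 'rV[int]_2, pairing u x = 1.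
Proof.
rewrite primitive_coprime; split=> [g1|[u]].
  have [a [b ab]] := Bezoutz (x 0 0) (x 0 1).
  by exists (row2 a b); rewrite pairingE row2E0 row2E1 ab /gcdz g1.
rewrite pairingE => e; apply/eqP; rewrite -dvdn1.
have : (1 : int) \in dvdz (gcdz (x 0 0) (x 0 1)).
  by rewrite -e rpredD // dvdz_mull ?dvdz_gcdl ?dvdz_gcdr.
by rewrite dvdzE.
Qed.

Lemma primitive_mulmx (x : 'rV[int]_2) B : primitive (x *m B) -> primitive x.
Proof.
move=> /primitiveP[u]; rewrite pairing_mulmx => e.
by apply/primitiveP; eexists; exact: e.
Qed.

Lemma primitive_unit (x : 'rV[int]_2) U :
  U \in unitmx -> primitive x -> primitive (x *m U).
Proof.
by move=> Uu px; apply: (@primitive_mulmx _ (invmx U)); rewrite mulmxK.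
Qed.

Lemma primitive_cross (x y : 'rV[int]_2) : `|cross x y|%N = 1%N -> primitive x.
Proof.
(* Up to sign, the cross product with [y] is a Bezout functional for [x]; the factor [cross x y]
   makes that sign square to 1. *)
move=> e; apply/primitiveP; exists (row2 (cross x y * y 0 1) (- cross x y * y 0 0)).
rewrite pairingE row2E0 row2E1; transitivity (cross x y * cross x y).
  by rewrite /cross; ring.
have : cross x y = 1 \/ cross x y = -1 by lia.
by case=> ->.
Qed.

(** With (c,d) the second row of [C] and [u] a Bezout functional for it, the first column of [V] is
    (d,-c) with the sign of the determinant: it kills the second row and gives l on the first. The
    second column is [u] plus a multiple of (d,-c), chosen to reduce the upper right entry modulo
    l. *)
Lemma hermite_normal_form (C : 'M[int]_2) (l : nat) : (0 < l)%N -> `|\det C|%N = l ->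
  primitive (row2 0 1 *m C) ->
  exists V, exists i : nat,
    [/\ V \in unitmx, (i < l)%N & C *m V = mx22 l%:Z i%:Z 0 1].
Proof.
move=> l0 dC /primitiveP[u]; rewrite pairingE !mulmx2E row2E0 row2E1 !mul0r !add0r !mul1r.
move: dC; rewrite det22.
set a := C 0 0; set b := C 0 1; set c := C 1 0; set d := C 1 1 => dC e.
set p := u 0 0 in e *; set q := u 0 1 in e *.
pose dl := a * d - b * c; pose k := a * p + b * q.
pose sg := sgz dl; pose m := - sg * (k %/ l)%Z.
have dlE : dl * sg = l%:Z by move: dC; rewrite -/dl /sg; case: (sgzP dl); lia.
pose V := mx22 (d * sg) (d * m + p) (- c * sg) (- c * m + q).
have kE : dl * m + k = (k %% l)%Z.
  have h := divz_eq k l.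
  have -> : dl * m = - (l%:Z * (k %/ l)%Z) by rewrite /m -dlE; ring.
  by rewrite addrC; apply/eqP; rewrite subr_eq addrC mulrC; apply/eqP.
have ki : (k %% l)%Z = `|(k %% l)%Z|%N by rewrite gez0_abs // modz_ge0 //; lia.
exists V, `|(k %% l)%Z|%N; split.
- rewrite unitmxE det22 /V !mx22E.
  have -> : d * sg * (- c * m + q) - (d * m + p) * (- c * sg) = sg * (p * c + q * d) by ring.
  rewrite e mulr1 /sg unitrE.
  by have := dlE; rewrite /sg; case: (sgzP dl) => // _; lia.
- by rewrite -ltz_nat -ki ltz_mod //; lia.
- apply/matrixP=> i j; rewrite mulmx2E.
  case: (ord2P i) => ->; case: (ord2P j) => ->; rewrite /V !mx22E -/a -/b -/c -/d.
  + by rewrite -dlE /dl; ring.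
  + by rewrite -ki -kE /dl /k; ring.
  + ring.
  + by rewrite -e; ring.
Qed.

Lemma pairingC (T : comPzRingType) (u x : 'rV[T]_2) : pairing u x = pairing x u.
Proof. by rewrite !pairingE; ring. Qed.

Definition perp (T : pzRingType) (e : 'rV[T]_2) : 'rV[T]_2 := row2 (e 0 1) (- e 0 0).

Lemma pairing_perp (T : comPzRingType) c (e x : 'rV[T]_2) :
  pairing (c *: perp e) x = c * cross x e.
Proof.
have Z j : (c *: perp e) 0 j = c * perp e 0 j by rewrite mxE.
by rewrite pairingE !Z row2E0 row2E1 /cross; ring.
Qed.

(** The columns of [U] are [perp v] and [u]. In the new coordinates v is the point (0,1) and u the
    second coordinate function, which is exactly the normalisation asked of representatives. *)
Lemma exists_dual_basis (u v : 'rV[int]_2) : pairing u v = 1 ->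
  exists2 U, U \in unitmx & v *m U = row2 0 1 /\ row2 0 1 *m U^T = u.
Proof.
rewrite pairingE => e; exists (mx22 (v 0 1) (u 0 0) (- v 0 0) (u 0 1)).
  rewrite unitmxE det22 !mx22E (_ : _ - _ = 1) ?unitr1 //.
  by rewrite -e; ring.
have T (A : 'M[int]_2) i j : A^T i j = A j i by rewrite mxE.
split; apply: rv2P; rewrite !mulmx2E ?T !mx22E ?row2E0 ?row2E1; try ring.
by rewrite -e; ring.
Qed.

Lemma unit_map_intr (B : 'M[int]_2) : \det B != 0 -> (map_mx intr B : 'M[rat]_2) \in unitmx.
Proof. by move=> d; rewrite unitmxE det_map_mx unitfE intr_eq0. Qed.

Lemma mulmx_inj (B : 'M[int]_2) : \det B != 0 -> injective (fun x : 'rV[int]_2 => x *m B).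
Proof.
move=> /unit_map_intr u x y /(congr1 toQ); rewrite !toQ_mulmx => /(congr1 (mulmxr (invmx (map_mx intr B)))).
by rewrite /= !mulmxK // => /toQ_inj.
Qed.

Lemma unit_det (U : 'M[int]_2) : U \in unitmx -> `|\det U|%N = 1%N.
Proof. by rewrite unitmxE => /orP[] /eqP ->. Qed.

Lemma unit_det_neq0 (U : 'M[int]_2) : U \in unitmx -> \det U != 0.
Proof. by move/unit_det; case: eqP => // ->. Qed.

(** * Steps and vertices of loops *)

Lemma cnth_mod s k : cnth s (k %% size s) = cnth s k.
Proof. by rewrite /cnth modn_mod. Qed.

Lemma cnthD s k : cnth s (k + size s) = cnth s k.
Proof. by rewrite /cnth modnDr. Qed.

Lemma cnth_succ_mod s k : cnth s (k %% size s).+1 = cnth s k.+1.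
Proof. by rewrite /cnth -[(k %% _).+1]addn1 modnDml addn1. Qed.

Lemma cnth_small s k : (k < size s)%N -> cnth s k = s`_k.
Proof. by move=> h; rewrite /cnth modn_small. Qed.

Lemma cnth_mem s k : (0 < size s)%N -> cnth s k \in s.
Proof. by move=> h; rewrite mem_nth // ltn_pmod. Qed.

Lemma cnth_mulmx s (B : 'M[int]_2) k :
  cnth [seq x *m B | x <- s] k = cnth s k *m B.
Proof.
rewrite /cnth size_map; case: (ltnP (k %% size s) (size s)) => h.
  by rewrite (nth_map 0).
by rewrite !nth_default ?size_map // mul0mx.
Qed.

Lemma cnth_rot s m k : (m <= size s)%N -> cnth (rot m s) k = cnth s (k + m).
Proof.
case: (posnP (size s)) => [s0|s0] ms.
  by move: ms; rewrite s0 leqn0 => /eqP->; rewrite rot0 addn0.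
rewrite /cnth size_rot -[in RHS]modnDml; set j := (k %% _)%N.
have js : (j < size s)%N by rewrite ltn_pmod.
clearbody j; rewrite /rot nth_cat size_drop; case: ltnP => h.
  by rewrite nth_drop addnC modn_small // addnC -ltn_subRL.
have aux n : (m <= n -> j < n -> n - m <= j ->
    (j - (n - m) < m) /\ j + m = (j - (n - m)) + n)%N by lia.
have [a1 a2] := aux _ ms js h.
by rewrite nth_take // a2 modnDr modn_small // (leq_trans a1).
Qed.

Lemma map_cnth_iota s m : (m <= size s)%N ->
  [seq cnth s k | k <- iota m (size s)] = rot m s.
Proof.
move=> ms; apply: (@eq_from_nth _ 0); first by rewrite size_map size_iota size_rot.
move=> i; rewrite size_map size_iota => iS.
rewrite (nth_map 0%N) ?size_iota // nth_iota // addnC -cnth_rot //.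
by rewrite cnth_small // size_rot.
Qed.

Lemma is_vertex_mod s k : is_vertex s (k %% size s) = is_vertex s k.
Proof.
rewrite /is_vertex cnth_mod cnth_succ_mod.
by rewrite -(cnth_mod s (_ + _)) modnDml cnth_mod.
Qed.

(** At a successor index the cyclic predecessor is plainly [k], which avoids the wrap-around
    [k + (size s).-1]. *)
Lemma is_vertexS s k : (0 < size s)%N ->
  is_vertex s k.+1 = (size s = 1%N \/
    ~ hull [:: cnth s k; cnth s k.+2] (toQ (cnth s k.+1))).
Proof.
by move=> s0; rewrite /is_vertex addSnnS prednK // cnthD.
Qed.

Lemma is_vertex_rot s m k : (m <= size s)%N ->
  is_vertex (rot m s) k = is_vertex s (k + m).
Proof.
by move=> ms; rewrite /is_vertex !cnth_rot // size_rot addSn addnAC.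
Qed.

Lemma mem_loop_vertices s x :
  x \in loop_vertices s <->
  exists k, [/\ (k < size s)%N, is_vertex s k & x = cnth s k].
Proof.
split=> [/mapP[k]|[k [ks vk ->]]].
  by rewrite mem_filter mem_iota => /andP[/asboolP vk /andP[_ ks]] ->; exists k.
by apply/mapP; exists k => //; rewrite mem_filter mem_iota /= ks andbT; apply/asboolP.
Qed.

Lemma cnth_loop_vertices s k : (0 < size s)%N -> is_vertex s k ->
  cnth s k \in loop_vertices s.
Proof.
move=> s0 vk; apply/mem_loop_vertices; exists (k %% size s)%N.
by rewrite ltn_pmod // cnth_mod is_vertex_mod.
Qed.

Lemma hull2_mulmx (B : 'M[int]_2) a b c : \det B != 0 ->
  hull [:: a *m B; b *m B] (toQ (c *m B)) = hull [:: a; b] (toQ c).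
Proof.
move=> /unit_map_intr uB; apply/propext; rewrite !hull2P.
split=> -[t t01 e]; exists t => //; move: e; rewrite !toQ_mulmx -mulmxBl scalemxAl -mulmxDl.
  by move/(congr1 (mulmxr (invmx (map_mx intr B)))); rewrite /= !mulmxK.
by move=> ->.
Qed.

Lemma is_vertex_mulmx (B : 'M[int]_2) s k : \det B != 0 ->
  is_vertex [seq x *m B | x <- s] k = is_vertex s k.
Proof. by move=> dB; rewrite /is_vertex size_map !cnth_mulmx hull2_mulmx. Qed.

Lemma loop_vertices_mulmx (B : 'M[int]_2) s : \det B != 0 ->
  loop_vertices [seq x *m B | x <- s] = [seq x *m B | x <- loop_vertices s].
Proof.
move=> dB; rewrite /loop_vertices size_map -map_comp.
under eq_map do rewrite cnth_mulmx.
congr map; apply: eq_filter => k.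
by rewrite is_vertex_mulmx.
Qed.

Lemma hull2_mid (a b c : 'rV[int]_2) : b - a = c - b -> hull [:: a; c] (toQ b).
Proof.
move=> e; apply/hull2P; exists 2%:R^-1; first by lra.
apply/rowP=> j; have := congr1 (fun m : 'rV_2 => (m 0 j)%:~R : rat) e.
by rewrite !mxE !rmorphB /=; lra.
Qed.

(* Both steps being primitive, parallel and equally oriented forces them to be equal. *)
Lemma nonvertex_step (a b c : 'rV[int]_2) :
  primitive (b - a) -> primitive (c - b) -> hull [:: a; c] (toQ b) ->
  c - b = b - a.
Proof.
move=> /primitiveP[u ud] /primitiveP[w wd] /hull2P[t t01 e].
have ej j : (b 0 j)%:~R = (a 0 j)%:~R + t * ((c 0 j)%:~R - (a 0 j)%:~R) :> rat.
  by have := congr1 (fun m : 'rV_2 => m 0 j) e; rewrite !mxE.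
have dj j : (1 - t) * ((b - a) 0 j)%:~R = t * ((c - b) 0 j)%:~R.
  by rewrite !mxE !rmorphB /= (ej j); ring.
have pq (v : 'rV[int]_2) :
    (1 - t) * (pairing v (b - a))%:~R = t * (pairing v (c - b))%:~R.
  by rewrite !pairingE !rmorphD !rmorphM /= !mulrDr !(mulrCA _ (v 0 _)%:~R) !dj.
have := pq u; have := pq w; rewrite ud wd !mulr1.
set m := pairing u _; set m' := pairing w _ => e1 e2.
have t0 : t != 0 by apply/eqP => t0; move: e2; rewrite t0 mul0r subr0; lra.
have mm : m * m' = 1.
  apply: (@intr_inj rat); rewrite rmorphM /=; apply: (mulfI t0).
  by rewrite mulrA -e2 e1 mulr1.
have m1 : m = 1.
  have /eqP := congr1 absz mm; rewrite abszM muln_eq1 => /andP[/eqP am _].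
  have : m = 1 \/ m = -1 by clear -am; lia.
  case=> // m1; exfalso; move: e2; rewrite m1 rmorphN rmorph1; lra.
have t2 : t = 2%:R^-1 by move: e2; rewrite m1 rmorph1; lra.
apply/rowP=> j; apply: (@intr_inj rat); have := dj j; rewrite t2; lra.
Qed.

Lemma reflexive_loop_steps l s : reflexive_loop l s -> forall k,
  [/\ primitive (cnth s k.+1 - cnth s k),
      `|cross (cnth s k) (cnth s k.+1)|%N = l
    & is_vertex s k -> primitive (cnth s k)].
Proof.
move=> [s0 _ h] k; have := h (k %% size s)%N; rewrite ltn_pmod // => /(_ isT).
by rewrite cnth_mod cnth_succ_mod det2E is_vertex_mod.
Qed.

Lemma reflexive_loop_nonvertex l s k : reflexive_loop l s -> ~ is_vertex s k.+1 ->
  cnth s k.+2 - cnth s k.+1 = cnth s k.+1 - cnth s k.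
Proof.
move=> rs; have [s0 _ _] := rs; rewrite is_vertexS // => /not_orP[_ /contrapT h].
have [p1 _ _] := reflexive_loop_steps rs k; have [p2 _ _] := reflexive_loop_steps rs k.+1.
exact: nonvertex_step.
Qed.

Lemma cross0l (x : 'rV[int]_2) : cross 0 x = 0.
Proof. by rewrite /cross !mxE; ring. Qed.

Lemma reflexive_loopI l s : (0 < l)%N -> (0 < size s)%N ->
  (forall k, [/\ primitive (cnth s k.+1 - cnth s k),
      `|cross (cnth s k) (cnth s k.+1)|%N = l
    & is_vertex s k -> primitive (cnth s k)]) -> reflexive_loop l s.
Proof.
move=> l0 s0 h; split=> // [x /(nthP 0)[i si <-]|k _].
  rewrite -cnth_small // => e; have [_ e2 _] := h i; move: e2.
  by rewrite e cross0l => e2; move: l0; rewrite -e2.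
by have := h k; rewrite det2E.
Qed.

Lemma reflexive_loop_rot l s m : (0 < l)%N -> (m <= size s)%N ->
  reflexive_loop l (rot m s) -> reflexive_loop l s.
Proof.
move=> l0 ms rs; have [s0 _ _] := rs; rewrite size_rot in s0.
apply: reflexive_loopI => // k; have := reflexive_loop_steps rs (k + (size s - m)).
rewrite -!addSn is_vertex_rot // !cnth_rot // -!addnA subnK // !cnthD.
by rewrite -(is_vertex_mod s (k + _)) modnDr is_vertex_mod.
Qed.

Lemma reflexive_loop_mulmx l s U : (0 < l)%N -> U \in unitmx ->
  reflexive_loop l s -> reflexive_loop l [seq x *m U | x <- s].
Proof.
move=> l0 uU rs; have [s0 _ _] := rs.
apply: reflexive_loopI; rewrite ?size_map // => k.
have [p c v] := reflexive_loop_steps rs k.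
rewrite !cnth_mulmx -mulmxBl cross_mulmx abszM (unit_det uU) muln1; split=> //.
  exact: primitive_unit.
by rewrite is_vertex_mulmx ?unit_det_neq0 // => /v; exact: primitive_unit.
Qed.

(** The determinant of [B] cancels the index. In the preimage consecutive points have determinant 1
    or -1, so every point, vertex or not, is primitive. *)
Lemma reflexive_loop_div l s B : (0 < l)%N -> `|\det B|%N = l ->
  reflexive_loop l [seq x *m B | x <- s] -> reflexive_loop 1 s.
Proof.
move=> l0 dB rs; have [s0 _ _] := rs; rewrite size_map in s0.
apply: reflexive_loopI => // k.
have [p c v] := reflexive_loop_steps rs k; move: c p.
rewrite !cnth_mulmx -mulmxBl cross_mulmx abszM dB => c p.
have c1 : `|cross (cnth s k) (cnth s k.+1)|%N = 1%N.
  by apply/eqP; rewrite -(eqn_pmul2r l0) mul1n c.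
split=> // [|_]; first exact: primitive_mulmx p.
exact: primitive_cross c1.
Qed.

Lemma primitive_cross_eq0 (x y : 'rV[int]_2) : primitive x -> cross x y = 0 ->
  exists c : int, y = c *: x.
Proof.
move=> /primitiveP[u]; rewrite pairingE /cross => e c0.
exists (pairing u y); rewrite pairingE; apply: rv2P; rewrite mxE.
  transitivity ((u 0 0 * x 0 0 + u 0 1 * x 0 1) * y 0 0
    + u 0 1 * (x 0 0 * y 0 1 - x 0 1 * y 0 0)); last by ring.
  by rewrite e c0; ring.
transitivity ((u 0 0 * x 0 0 + u 0 1 * x 0 1) * y 0 1
  - u 0 0 * (x 0 0 * y 0 1 - x 0 1 * y 0 0)); last by ring.
by rewrite e c0; ring.
Qed.

(* Consecutive determinants agree up to sign, so each point is an integral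
   combination of the two preceding ones. *)
Lemma loop_lattice l s : reflexive_loop l s ->
  forall k, exists q : 'rV[int]_2, cnth s k = q *m rows2 (cnth s 0) (cnth s 1).
Proof.
move=> rs; set B := rows2 _ _.
have step k : exists c d : int, cnth s k.+2 = c *: cnth s k.+1 + d *: cnth s k.
  case: (pselect (is_vertex s k.+1)) => vk; last first.
    have := reflexive_loop_nonvertex rs vk => /eqP; rewrite subr_eq => /eqP ->.
    by exists 2, (-1); apply/rowP=> j; rewrite !mxE; ring.
  have [_ c1 _] := reflexive_loop_steps rs k.
  have [_ c2 /(_ vk) p] := reflexive_loop_steps rs k.+1.
  (* Since the two determinants agree up to sign, adding or subtracting the point [k] makes the
     point [k.+2] parallel to the vertex [k.+1]; primitivity of that vertex makes the factor an
     integer. *)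
  have [e ee] : exists e : int, cross (cnth s k.+1) (cnth s k.+2 + e *: cnth s k) = 0.
    have : cross (cnth s k) (cnth s k.+1) = cross (cnth s k.+1) (cnth s k.+2) \/
           cross (cnth s k) (cnth s k.+1) = - cross (cnth s k.+1) (cnth s k.+2) by lia.
    have lin (a b c : 'rV[int]_2) e : cross a (b + e *: c) = cross a b - e * cross c a.
      by rewrite /cross !mxE; ring.
    by case=> h; [exists 1|exists (-1)]; rewrite lin h; ring.
  have [c h] := primitive_cross_eq0 p ee.
  by exists c, (- e); rewrite -h scaleNr addrK.
have [h0 h1] : (exists q : 'rV[int]_2, cnth s 0 = q *m B) /\
   (exists q : 'rV[int]_2, cnth s 1 = q *m B).
  split; [exists (row2 1 0)|exists (row2 0 1)];
    by apply: rv2P; rewrite mulmx2E row2E0 row2E1 !mxE /=; ring.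
have : forall k, (exists q : 'rV[int]_2, cnth s k = q *m B) /\
   (exists q : 'rV[int]_2, cnth s k.+1 = q *m B).
  elim=> [//|k [[q hq] [q' hq']]]; split; first by exists q'.
  have [c [d ->]] := step k; exists (c *: q' + d *: q).
  by rewrite mulmxDl -!scalemxAl -hq -hq'.
by move=> h k; case: (h k).
Qed.

Lemma seq_preim (T T' : eqType) (f : T -> T') (s : seq T') :
  (forall y, y \in s -> exists x, y = f x) -> exists s', s = map f s'.
Proof.
elim: s => [|y s IH] h; first by exists [::].
have [x xy] := h y (mem_head _ _).
have [s' ->] := IH (fun z zs => h z (mem_behead (s := y :: s) zs)).
by exists (x :: s'); rewrite xy.
Qed.

(** * Recovering a loop from its vertices *)

Lemma lattice_segment_progression (x d : 'rV[int]_2) m : primitive d ->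
  lattice_segment x (x + d *+ m) = [seq x + d *+ j | j <- iota 0 m.+1].
Proof.
move=> /primitive_coprime g1; rewrite /lattice_segment addrC addKr.
have gE : gcdn `|(d *+ m)%R 0 0| `|(d *+ m)%R 0 1| = m.
  by rewrite !mulmxnE -(mulr_natr (d 0 0)) -(mulr_natr (d 0 1)) !natz !abszM /= -muln_gcdl g1 mul1n.
rewrite gE; case: m gE => [|m] _.
  by rewrite /= !mulr0n.
congr map; apply/funext=> j; congr (_ + _ *+ _).
by apply/rowP=> i; rewrite mxE mulmxnE -mulr_natr natz mulzK.
Qed.

Lemma squeeze_cons x y s : x <> y -> squeeze (x :: y :: s) = x :: squeeze (y :: s).
Proof. by move=> /eqP/negbTE xy; rewrite /= xy. Qed.

(** Successive values of [f] differ, so the only repetition is at the junction, where the end of one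
    segment is the start of the next. *)
Lemma squeeze_cat (f : nat -> 'rV[int]_2) a m t :
  (forall j, f j <> f j.+1) ->
  squeeze ([seq f j | j <- iota a m.+1] ++ f (a + m)%N :: t) =
  [seq f j | j <- iota a m] ++ squeeze (f (a + m)%N :: t).
Proof.
move=> fS; elim: m a => [|m IH] a; first by rewrite addn0 /= eqxx.
transitivity (f a :: squeeze ([seq f j | j <- iota a.+1 m.+1] ++ f (a.+1 + m)%N :: t)).
  by rewrite addSnnS; apply: squeeze_cons.
by rewrite IH addSnnS.
Qed.

Lemma squeeze_map_iota (f : nat -> 'rV[int]_2) a m :
  (forall j, f j <> f j.+1) ->
  squeeze [seq f j | j <- iota a m] = [seq f j | j <- iota a m].
Proof.
move=> fS; elim: m a => [//|m IH] a.
rewrite -[iota a m.+1]/(a :: iota a.+1 m) map_cons -[in RHS]IH.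
by case: m {IH} => [//|m]; apply: squeeze_cons.
Qed.

(** Indices are not reduced modulo the length, so [b] may lie in the next turn. *)
Definition walk s a b := [seq cnth s j | j <- iota a (b - a).+1].

Lemma squeeze_walks s a K : (forall j, cnth s j <> cnth s j.+1) -> K != [::] ->
  path leq a K -> squeeze (flatten (pairmap (walk s) a K)) = walk s a (last a K).
Proof.
move=> sS; elim: K a => [//|b K IH] a _; rewrite [path _ _ _]/= => /andP[ab pK].
have -> : flatten (pairmap (walk s) a (b :: K)) =
  walk s a b ++ flatten (pairmap (walk s) b K) by [].
rewrite [last _ _]/=.
case: K IH pK => [|c K] IH pK; first by rewrite cats0 /walk squeeze_map_iota.
have {}IH := IH b isT pK.
have -> : flatten (pairmap (walk s) b (c :: K)) =
    cnth s (a + (b - a)) :: behead (flatten (pairmap (walk s) b (c :: K))).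
  by rewrite subnKC.
rewrite [walk s a b]/walk squeeze_cat // subnKC //.
have -> : cnth s b :: behead (flatten (pairmap (walk s) b (c :: K))) =
  flatten (pairmap (walk s) b (c :: K)) by [].
rewrite IH /walk -map_cat.
have bl : (b <= last b (c :: K))%N.
  by move: (order_path_min leq_trans pK) => /allP; apply; rewrite /= mem_last.
have -> : ((last b (c :: K) - a).+1 = (b - a) + (last b (c :: K) - b).+1)%N by lia.
by rewrite iotaD subnKC.
Qed.

(** Used with [p] the vertex predicate: each gap between consecutive entries contains no vertex,
    hence is one edge. The end point [c + m] is appended whether or not it satisfies [p]; in the
    application it is the first vertex one turn later. *)
Lemma path_filter_iota (p : pred nat) a c m : (a < c)%N ->
  (forall j, (a < j < c)%N -> ~~ p j) ->
  path (fun x y => (x < y)%N && all (predC p) (iota x.+1 (y - x.+1))) a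
    (rcons (filter p (iota c m)) (c + m)%N).
Proof.
elim: m a c => [|m IH] a c ac h.
  rewrite addn0 /= ac andbT; apply/allP=> j; rewrite mem_iota => /andP[aj jc] /=.
  by apply: h; lia.
rewrite -[iota c m.+1]/(c :: iota c.+1 m) -addSnnS /=; case: ifP => pc /=.
  rewrite ac /= IH // ?andbT => [|j]; last by lia.
  by apply/allP=> j; rewrite mem_iota => /andP[aj jc] /=; apply: h; lia.
apply: IH => [|j /andP[aj jc]]; first by lia.
case: (ltngtP j c) => jc'; [by apply: h; lia|by lia|by rewrite jc' pc].
Qed.

Lemma reflexive_loop_neq l s k : reflexive_loop l s -> cnth s k <> cnth s k.+1.
Proof.
move=> rs e; have [[d0 _] _ _] := reflexive_loop_steps rs k.
by apply: d0; rewrite e subrr.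
Qed.

(** All steps between [a] and [b] equal the first one, because no vertex intervenes. That step is
    primitive, so the progression misses no lattice point of the segment. *)
Lemma lattice_segment_walk l s a b : reflexive_loop l s -> (a <= b)%N ->
  (forall j, (a < j < b)%N -> ~ is_vertex s j) ->
  lattice_segment (cnth s a) (cnth s b) = walk s a b.
Proof.
move=> rs ab nv; set d := cnth s a.+1 - cnth s a.
have [pd _ _] := reflexive_loop_steps rs a.
have aux j : (a + j <= b)%N -> cnth s (a + j) = cnth s a + d *+ j /\
    ((a + j < b)%N -> cnth s (a + j).+1 - cnth s (a + j) = d).
  elim: j => [|j IH] jb; first by rewrite addn0 mulr0n addr0.
  have [|IH1 IH2] := IH; first by lia.
  have {}IH2 : cnth s (a + j).+1 - cnth s (a + j) = d by apply: IH2; lia.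
  split=> [|jb'].
    by rewrite addnS mulrSr addrA -IH1 -IH2 addrC subrK.
  by rewrite addnS (reflexive_loop_nonvertex rs) // -addnS; apply: nv; lia.
have [eb _] := aux (b - a)%N ltac:(lia); rewrite subnKC // in eb.
rewrite eb lattice_segment_progression // /walk.
have -> n : iota a n = map (addn a) (iota 0 n) by rewrite -iotaDl addn0.
rewrite -map_comp.
by apply/eq_in_map => j; rewrite mem_iota => jb /=; case: (aux j) => [|-> //]; lia.
Qed.

(** A total order compatible with convexity. Unlike a linear functional it has no ties between
    distinct points, so a maximum is always extreme. *)
Definition lexle (x y : 'rV[int]_2) : bool :=
  (x 0 0 < y 0 0) || (x 0 0 == y 0 0) && (x 0 1 <= y 0 1).

Lemma lexle_max (T : eqType) (f : T -> 'rV[int]_2) (s : seq T) : s != [::] ->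
  exists2 m, m \in s & forall x, x \in s -> lexle (f x) (f m).
Proof.
have refl x : lexle x x by rewrite /lexle eqxx lexx orbT.
have trans x y z : lexle x y -> lexle y z -> lexle x z by rewrite /lexle; lia.
have total x y : lexle x y || lexle y x by rewrite /lexle; lia.
elim: s => [//|x [|y s] IH] _.
  by exists x => [|z]; rewrite inE // => /eqP ->.
have [//|m ms h] := IH.
case/orP: (total (f x) (f m)) => xm.
  by exists m => [|z]; rewrite inE ?ms ?orbT // => /orP[/eqP->|/h].
exists x => [|z]; rewrite inE ?eqxx // => /orP[/eqP->//|/h zm].
exact: trans zm xm.
Qed.

Lemma hull2_coords (a b c : 'rV[int]_2) : hull [:: a; c] (toQ b) ->
  exists2 t : rat, 0 <= t <= 1 &
    forall j, (1 - t) * ((b 0 j)%:~R - (a 0 j)%:~R) =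
              t * ((c 0 j)%:~R - (b 0 j)%:~R).
Proof.
move=> /hull2P[t t01 e]; exists t => // j.
by have := congr1 (fun m : 'rV_2 => m 0 j) e; rewrite !mxE => ->; ring.
Qed.

Lemma hull2_lexmax (a b c : 'rV[int]_2) : hull [:: a; c] (toQ b) ->
  lexle a b -> lexle c b -> a = b \/ c = b.
Proof.
move=> /hull2_coords[t /andP[t0 t1] h] ab cb.
case: (eqVneq t 0) => [tz|tz].
  by left; apply/rowP=> j; apply: (@intr_inj rat); have := h j; rewrite tz; lra.
case: (eqVneq t 1) => [tz1|tz1].
  by right; apply/rowP=> j; apply: (@intr_inj rat); have := h j; rewrite tz1; lra.
have {t0 tz}t0 : 0 < t by rewrite lt_neqAle eq_sym tz.
have {t1 tz1}t1 : 0 < 1 - t by rewrite subr_gt0 lt_neqAle tz1.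
(* Both weights are positive and the weighted differences are equal but of opposite sign, so both
   vanish. This applies first to the coordinate 0 and then, by the tie, to the coordinate 1. *)
have aux j : a 0 j <= b 0 j -> c 0 j <= b 0 j -> a 0 j = b 0 j /\ c 0 j = b 0 j.
  rewrite -!(ler_int rat) => h1 h2; have := h j.
  have p1 : 0 <= (1 - t) * ((b 0 j)%:~R - (a 0 j)%:~R) by rewrite mulr_ge0; lra.
  have p2 : t * ((c 0 j)%:~R - (b 0 j)%:~R) <= 0 by rewrite mulr_ge0_le0; lra.
  move=> e; have /eqP : (1 - t) * ((b 0 j)%:~R - (a 0 j)%:~R) = 0 by lra.
  have /eqP : t * ((c 0 j)%:~R - (b 0 j)%:~R) = 0 by lra.
  rewrite !mulf_eq0 (gt_eqF t0) (gt_eqF t1) /= !subr_eq0 !eqr_int => /eqP -> /eqP ->.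
  by [].
left; have [|| e0 e0'] := aux 0; [by move: ab; rewrite /lexle; lia|by move: cb; rewrite /lexle; lia|].
have [|| e1 e1'] := aux 1; [by move: ab; rewrite /lexle e0; lia|by move: cb; rewrite /lexle e0'; lia|].
exact: rv2P.
Qed.

(** Each coordinate of [b] lies between those of [a] and [c]. The delicate case is a tie in the
    first coordinate with one end only; then [b] is that end ([end0], [end1]). *)
Lemma hull2_lexle (a b c m : 'rV[int]_2) : hull [:: a; c] (toQ b) ->
  lexle a m -> lexle c m -> lexle b m.
Proof.
move=> /hull2_coords[t /andP[t0 t1] h] am cm.
have sg j : (a 0 j <= b 0 j <= c 0 j) || (c 0 j <= b 0 j <= a 0 j).
  have := h j; case: (eqVneq t 1) => [->|t1'] hj.
    have : b 0 j = c 0 j by apply: (@intr_inj rat); lra.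
    by lia.
  have {t1 t1'}t1 : 0 < 1 - t by rewrite subr_gt0 lt_neqAle t1'.
  case: (lerP (b 0 j) (c 0 j)) => bc.
    have : (0 : rat) <= (b 0 j)%:~R - (a 0 j)%:~R.
      by rewrite -(pmulr_rge0 _ t1) hj mulr_ge0 // subr_ge0 ler_int.
    by rewrite subr_ge0 ler_int => ->.
  have : ((b 0 j)%:~R - (a 0 j)%:~R : rat) <= 0.
    by rewrite -(pmulr_rle0 _ t1) hj mulr_ge0_le0 // subr_le0 ler_int ltW.
  by rewrite subr_le0 ler_int => ->; rewrite /= (ltW bc) orbT.
have end0 : b 0 0 = a 0 0 -> a 0 0 != c 0 0 -> b 0 1 = a 0 1.
  rewrite -(inj_eq (@intr_inj rat)) -subr_eq0 => e ac; have := h 0.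
  rewrite e subrr mulr0 => /esym/eqP; rewrite mulf_eq0 -opprB oppr_eq0 (negbTE ac) orbF.
  by move=> /eqP tz; apply: (@intr_inj rat); have := h 1; rewrite tz; lra.
have end1 : b 0 0 = c 0 0 -> a 0 0 != c 0 0 -> b 0 1 = c 0 1.
  rewrite -(inj_eq (@intr_inj rat)) -subr_eq0 => e ac; have := h 0.
  rewrite e subrr mulr0 => /eqP; rewrite mulf_eq0 -[X in _ || X]oppr_eq0 opprB (negbTE ac) orbF.
  move=> /eqP tz; have ht : t = 1 by lra.
  by apply: (@intr_inj rat); have := h 1; rewrite ht; lra.
have := sg 0; have := sg 1; move: am cm end0 end1; rewrite /lexle; lia.
Qed.

(** A lexicographically largest point is a vertex: were it between its neighbours it would equal one
    of them, but consecutive points of a loop differ. *)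
Lemma loop_has_vertex l s : reflexive_loop l s ->
  exists2 k, (k < size s)%N & is_vertex s k.
Proof.
move=> rs; have [s0 _ _] := rs.
have [|x xs h] := @lexle_max _ id s; first by rewrite -size_eq0 -lt0n.
exists (index x s); first by rewrite index_mem.
(* A full turn is added to make the index a successor, so that [is_vertexS] applies. *)
have -> : is_vertex s (index x s) = is_vertex s (index x s + (size s).-1).+1.
  by rewrite -addnS prednK // -[RHS]is_vertex_mod modnDr is_vertex_mod.
rewrite is_vertexS //; set k := (_ + _)%N; right.
have xk : cnth s k.+1 = x by rewrite -addnS prednK // cnthD cnth_small ?index_mem // nth_index.
move=> hu; have [] := hull2_lexmax hu; rewrite ?xk; try exact/h/cnth_mem.
  by rewrite -xk; exact: (reflexive_loop_neq (k := k) rs).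
by rewrite -xk => /esym; exact: (reflexive_loop_neq (k := k.+1) rs).
Qed.

Lemma mem_squeeze s x : (x \in squeeze s) = (x \in s).
Proof.
elim: s => [//|y [//|z s] IH].
rewrite inE -IH /=; case: eqP => [->|_]; last by rewrite [in LHS]inE.
have : z \in squeeze (z :: s).
  by elim: s z {IH} => [|w s IH] z /=; [rewrite inE|case: eqP => [->|_]; [exact: IH|rewrite inE eqxx]].
by case: (x =P z) => // ->.
Qed.

Lemma head_squeeze s x0 : head x0 (squeeze s) = head x0 s.
Proof. by elim: s => [//|y [//|z s] IH] /=; case: eqP => [->|]. Qed.

Lemma last_squeeze s x0 : last x0 (squeeze s) = last x0 s.
Proof.
elim: s x0 => [//|y [//|z s] IH] x0 /=; case: eqP => [yz|_].
  exact: (IH x0).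
exact: (IH y).
Qed.

Lemma sorted_squeeze s : sorted (fun x y => x != y) (squeeze s).
Proof.
elim: s => [//|y [//|z s] IH] /=; case: eqP => [//|/eqP yz].
have := IH; have := head_squeeze (z :: s) 0; rewrite -/(squeeze (z :: s)).
case: (squeeze (z :: s)) (mem_squeeze (z :: s) z) => [|w t] /=; first by rewrite mem_head.
by move=> _ ->; rewrite yz.
Qed.

Lemma mem_cyclic_squeeze s x : (x \in cyclic_squeeze s) = (x \in s).
Proof.
rewrite -[in RHS]mem_squeeze /cyclic_squeeze; case: ifP => // /andP[].
case: (squeeze s) => [//|y [//|z t]] _ /= /eqP e.
have h : y \in z :: t by rewrite e; exact: mem_last.
by rewrite [RHS]inE; case: (x =P y) => [->|//]; exact: h.
Qed.

(** A list squeezed to a single point is its own successor, whence the bound on the size. When the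
    head is dropped, the last entry equals the dropped head and so still differs from the new first
    entry. *)
Lemma cnth_cyclic_squeeze s k : (1 < size (cyclic_squeeze s))%N ->
  cnth (cyclic_squeeze s) k <> cnth (cyclic_squeeze s) k.+1.
Proof.
suff cyc : (1 < size (cyclic_squeeze s))%N -> cycle (fun x y => x != y) (cyclic_squeeze s).
  move=> s1; have := cyc s1; set t := cyclic_squeeze s in s1 *.
  have t0 : (0 < size t)%N by lia.
  rewrite -(cnth_mod t k) -(cnth_succ_mod t k).
  have : (k %% size t < size t)%N by rewrite ltn_pmod.
  move: (k %% size t)%N => j; case: t {s1} t0 => [//|x t] _ jt.
  move=> /(pathP 0)/(_ j); rewrite size_rcons => /(_ jt)/eqP.
  rewrite -rcons_cons !nth_rcons jt cnth_small //.
  case: ltnP => jt'; first by rewrite cnth_small.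
  have -> : j = size t by move: jt jt' => /=; lia.
  by rewrite eqxx /cnth /= modnn.
have := sorted_squeeze s; rewrite /cyclic_squeeze.
case: (squeeze s) => [//|x [//|y t]] /=; case: (x =P last y t) => [e|/eqP ne] /=.
  rewrite rcons_path => /andP[xy ->] _ /=; rewrite -e //.
by move=> /andP[xy pt] _; rewrite xy rcons_path pt /= eq_sym ne.
Qed.

(** Since the image of a loop is defined through its vertices alone, this is what identifies that
    image with the pointwise image of the whole list. *)
Lemma loop_through_loop_vertices l s : reflexive_loop l s ->
  exists2 m, (m <= size s)%N & loop_through (loop_vertices s) = rot m s.
Proof.
move=> rs; have [k kn vk] := loop_has_vertex rs.
pose p j := `[< is_vertex s j >].
have exp : exists k, p k by exists k; apply/asboolP.
have [k0 pk0 mink0] := ex_minnP exp.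
have k0n : (k0 < size s)%N by apply: leq_ltn_trans kn; apply: mink0; apply/asboolP.
set n := size s in kn k0n *.
pose ks := filter p (iota k0.+1 (n - k0.+1)).
have np j : (j < k0)%N -> p j = false.
  by move=> jk; apply/negP => /mink0; rewrite leqNgt jk.
have E1 : filter p (iota 0 n) = k0 :: ks.
  have -> : (n = k0 + (n - k0.+1).+1)%N by lia.
  rewrite iotaD filter_cat add0n /= pk0 [filter p (iota 0 k0)](_ : _ = [::]) //=.
  apply/eqP; rewrite -(negbK (_ == _)) -has_filter; apply/negP => /hasP[j].
  by rewrite mem_iota => /andP[_ jk]; rewrite np.
(* Reading on past the end of the list meets the indices below [k0] of the next turn, and none of
   them is a vertex because [k0] is the first one. *)
have E2 : filter p (iota k0.+1 n.-1) = ks.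
  have -> : (n.-1 = (n - k0.+1) + k0)%N by lia.
  rewrite iotaD filter_cat [X in _ ++ X](_ : _ = [::]) ?cats0 //.
  apply/eqP; rewrite -(negbK (_ == _)) -has_filter; apply/negP => /hasP[j].
  rewrite mem_iota subnKC // => /andP[nj jk].
  have -> : p j = p (j - n)%N.
    by rewrite /p -(is_vertex_mod s (j - n)) -modnDr subnK // is_vertex_mod.
  by rewrite np //; lia.
(* The closing entry is [k0] one turn later, so that the walks along [K] go exactly once around. *)
pose K := rcons ks (k0 + n)%N.
have pK : path (fun x y => (x < y)%N && all (predC p) (iota x.+1 (y - x.+1))) k0 K.
  have := @path_filter_iota p k0 k0.+1 n.-1 (ltnSn _).
  rewrite E2 addSnnS prednK; last by lia.
  by apply=> j; lia.
have vsE : loop_vertices s = [seq cnth s j | j <- k0 :: ks] by rewrite -E1.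
have szK : size K = size (loop_vertices s) by rewrite vsE size_rcons size_map.
have E3 : [seq lattice_segment (cnth (loop_vertices s) i) (cnth (loop_vertices s) i.+1)
    | i <- iota 0 (size (loop_vertices s))] = pairmap (walk s) k0 K.
  apply: (@eq_from_nth _ [::]); first by rewrite size_map size_iota size_pairmap.
  move=> i; rewrite size_map size_iota => iS.
  rewrite (nth_map 0%N) ?size_iota // nth_iota // add0n (nth_pairmap 0%N) ?szK //.
  have /(pathP 0%N)/(_ i) := pK; rewrite szK iS => /(_ isT)/andP[lt /allP nv].
  have -> : cnth (loop_vertices s) i = cnth s (nth 0%N (k0 :: K) i).
    rewrite cnth_small // vsE (nth_map 0%N); last by rewrite vsE size_map in iS.
    by rewrite /K -rcons_cons nth_rcons; rewrite vsE size_map in iS; rewrite iS.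
  have -> : cnth (loop_vertices s) i.+1 = cnth s (nth 0%N K i).
    rewrite vsE size_map /= in iS; rewrite /K nth_rcons.
    case: ltnP => ik.
      by rewrite cnth_small vsE ?size_map //= (nth_map 0%N).
    have -> : i = size ks by lia.
    by rewrite eqxx cnthD vsE /cnth size_map /= modnn.
  rewrite (lattice_segment_walk rs) // 1?ltnW //.
  move=> j /andP[j1 j2] /asboolP pj.
  have : j \in iota (nth 0%N (k0 :: K) i).+1 (nth 0%N K i - (nth 0%N (k0 :: K) i).+1).
    by rewrite mem_iota; lia.
  by move=> /nv /=; rewrite /p pj.
have sS j : cnth s j <> cnth s j.+1 by exact: reflexive_loop_neq rs.
rewrite /loop_through E3 /cyclic_squeeze squeeze_walks //; first last.
  by apply: sub_path pK => x y /andP[/ltnW].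
  by rewrite /K; case: (ks).
have -> : last k0 K = (k0 + n)%N by rewrite /K last_rcons.
rewrite /walk addKn.
have -> : last 0 [seq cnth s j | j <- iota k0 n.+1] = cnth s (k0 + n).
  by rewrite -[n.+1]addn1 iotaD map_cat last_cat.
rewrite size_map size_iota /= cnthD eqxx andbT.
have -> : (1 < n.+1)%N by lia.
(* The rotation is by [k0.+1] and not [k0]: the walk starts and ends at the same point, and the
   cyclic squeeze drops its head. *)
by exists k0.+1; rewrite // map_cnth_iota.
Qed.

(** * Vertices of the dual loop *)

Lemma mem_loop_through us y : y \in loop_through us <->
  exists2 k, (k < size us)%N & hull [:: cnth us k; cnth us k.+1] (toQ y).
Proof.
rewrite /loop_through mem_cyclic_squeeze; split=> [/flattenP[t /mapP[k]]|[k kn h]].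
  by rewrite mem_iota => kn -> /mem_lattice_segment h; exists k.
apply/flattenP; exists (lattice_segment (cnth us k) (cnth us k.+1)).
  by apply/mapP; exists k => //; rewrite mem_iota.
exact/mem_lattice_segment.
Qed.

Lemma hull2_left (a b : 'rV[int]_2) : hull [:: a; b] (toQ a).
Proof. by apply/hull2P; exists 0; rewrite ?scale0r ?addr0 // lexx ler01. Qed.

(** The matrix [G] lets the lexicographic order be read in other coordinates: the normalisation
    selects a maximal normal before it changes the basis. A one-point list is covered by the
    convention in [is_vertex]. *)
Lemma loop_through_extreme us (G : 'M[int]_2) m : \det G != 0 -> m \in us ->
  (forall u, u \in us -> lexle (u *m G) (m *m G)) ->
  m \in loop_vertices (loop_through us).
Proof.
move=> dG mus h; have us0 : (0 < size us)%N by case: us mus {h}.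
set ys := loop_through us.
have hys y : y \in ys -> lexle (y *m G) (m *m G).
  move=> /mem_loop_through[k _]; rewrite -(hull2_mulmx _ _ _ dG) => /hull2_lexle; apply;
    exact/h/cnth_mem.
have mys : m \in ys.
  apply/mem_loop_through; exists (index m us); first by rewrite index_mem.
  rewrite [X in [:: X; _]]cnth_small ?index_mem // nth_index //; exact: hull2_left.
have ys0 : (0 < size ys)%N by case: (ys) mys.
pose k := (index m ys + (size ys).-1)%N.
have km : cnth ys k.+1 = m.
  by rewrite /k -addnS prednK // cnthD cnth_small ?index_mem // nth_index.
rewrite -km; apply: cnth_loop_vertices => //; rewrite is_vertexS //.
case: (eqVneq (size ys) 1%N) => [->|ys1]; [by left|right].
have ysS j : cnth ys j <> cnth ys j.+1.
  by apply: cnth_cyclic_squeeze; rewrite -/(loop_through us) -/ys; lia.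
rewrite -(hull2_mulmx _ _ _ dG) => /hull2_lexmax; rewrite km.
case; try exact/hys/cnth_mem.
  by move=> /(mulmx_inj dG); rewrite -km; exact: ysS.
by move=> /(mulmx_inj dG); rewrite -km => /esym; exact: (ysS k.+1).
Qed.

Section InnerTriples.
Variable us : seq 'rV[int]_2.

(** The invariant of a concatenation of lattice segments: an entry is either a corner or a
    non-vertex between its neighbours. The inequalities guarantee that an entry of the second kind
    is never part of a repetition. *)
Definition inner_triple (a b c : 'rV[int]_2) : Prop :=
  b \in us \/ [/\ hull [:: a; c] (toQ b), a <> b & b <> c].

Fixpoint inner_triples (s : seq 'rV[int]_2) : Prop :=
  if s is a :: s1 then
    (if s1 is b :: c :: _ then inner_triple a b c else True) /\ inner_triples s1
  else True.

Lemma inner_triples_nth s i : inner_triples s -> (i.+2 < size s)%N ->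
  inner_triple s`_i s`_i.+1 s`_i.+2.
Proof.
elim: i s => [|i IH] [//|a s] /= [h hs] si; last exact: IH.
by case: s h {hs} si => [//|b [//|c s]] /=.
Qed.

(** Every triple that straddles the junction has the doubled corner [x] in its middle. *)
Lemma inner_triples_cat s x t : x \in us -> inner_triples (rcons s x) ->
  inner_triples (x :: t) -> inner_triples (rcons s x ++ x :: t).
Proof.
move=> xus; elim: s => [|a s IH] /=.
  by move=> _ [h1 h2]; split; [case: t {h1 h2} => [//|b t]; left|split].
move=> [h hs] ht; split; last exact: IH.
case: s h {IH hs} => [|b [|c s]] //= _; left => //.
Qed.

(* Only points of [us] are repeated, so dropping a repetition creates no bad triple. *)
Lemma inner_triples_squeeze s : inner_triples s -> inner_triples (squeeze s).
Proof.
elim: s => [//|a [//|b s] IH] [h hs].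
have {}IH := IH hs.
case: (a =P b) => [ab|ab]; first by rewrite /= ab eqxx.
rewrite squeeze_cons //; split=> //.
have := head_squeeze (b :: s) 0; case E: (squeeze (b :: s)) => [//|b' [//|c' t]] /= bb.
rewrite {b'}bb in E *.
case: s h {hs IH} E => [//|c s] h.
case: (b =P c) => [bc|bc].
  by move=> _; case: h => [bus|[_ _ nbc]]; [left|case: nbc].
rewrite squeeze_cons // => /(congr1 behead) E0.
have E : squeeze (c :: s) = c' :: t by exact: E0.
have := head_squeeze (c :: s) 0; rewrite E /= => ->; exact: h.
Qed.

Lemma inner_triples_progression (x d : 'rV[int]_2) i m : d != 0 ->
  inner_triples [seq x + d *+ j | j <- iota i m].
Proof.
move=> d0; elim: m i => [//|m IH] i; split; last exact: IH.
case: m {IH} => [|[|m]] //=; right.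
have aux j : x + d *+ j <> x + d *+ j.+1.
  move/addrI/eqP; rewrite mulrSr -[X in X == _]addr0 (inj_eq (addrI _)) eq_sym.
  by rewrite (negbTE d0).
split; try exact: aux.
by apply: hull2_mid; rewrite !mulrSr; apply/rowP=> j; rewrite !mxE; ring.
Qed.

Lemma inner_triples_segment a b : inner_triples (lattice_segment a b).
Proof.
rewrite /lattice_segment; set g := gcdn _ _; set d := (\row_j _)%R.
have [d0|d0] := eqVneq d 0; last exact: inner_triples_progression.
suff -> : g = 0%N by [].
have dvd j : ((b - a) 0 j) \in dvdz g%:Z.
  by rewrite dvdzE /=; case: (ord2P j) => ->; [exact: dvdn_gcdl|exact: dvdn_gcdr].
have e j : (b - a) 0 j = 0.
  have := congr1 (fun m : 'rV_2 => m 0 j) d0; rewrite mxE [RHS]mxE => dj.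
  by rewrite -(divzK (dvd j)) dj mul0r.
by rewrite /g !e.
Qed.

Lemma lattice_segment_ends a b : exists s,
  lattice_segment a b = a :: s /\ last a s = b.
Proof.
have bs : b \in lattice_segment a b.
  apply/mem_lattice_segment/hull2P; exists 1; rewrite ?ler01 ?lexx //.
  by rewrite scale1r addrC subrK.
rewrite /lattice_segment; set g := gcdn _ _; set d := (\row_j _)%R.
exists [seq a + d *+ j | j <- iota 1 g]; split; first by rewrite /= mulr0n addr0.
have dvd j : ((b - a) 0 j) \in dvdz g%:Z.
  by rewrite dvdzE /=; case: (ord2P j) => ->; [exact: dvdn_gcdl|exact: dvdn_gcdr].
have -> : b = a + d *+ g.
  apply/rowP=> j; rewrite !mxE mulmxnE -mulr_natr natz [d 0 j]mxE divzK //.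
  by rewrite !mxE addrC subrK.
clear bs dvd; clearbody d g; case: g => [|g]; first by rewrite mulr0n addr0.
by rewrite -[X in iota _ X]addn1 iotaD map_cat last_cat.
Qed.
End InnerTriples.

Lemma inner_triples_flatten us (f : nat -> 'rV[int]_2) a m :
  (forall k, f k \in us) ->
  inner_triples us (flatten [seq lattice_segment (f k) (f k.+1) | k <- iota a m]).
Proof.
pose F i n := flatten [seq lattice_segment (f k) (f k.+1) | k <- iota i n].
move=> fus; rewrite -/(F a m); elim: m a => [//|m IH] a.
have FS i n : F i n.+1 = lattice_segment (f i) (f i.+1) ++ F i.+1 n by [].
have := inner_triples_segment us (f a) (f a.+1).
rewrite FS; have [s [-> sl]] := lattice_segment_ends (f a) (f a.+1); rewrite lastI sl => hs.
case: m IH => [|m] IH; first by rewrite cats0.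
have := IH a.+1; rewrite FS.
have [s' [-> _]] := lattice_segment_ends (f a.+1) (f a.+2).
by rewrite cat_cons; exact: inner_triples_cat.
Qed.

(** Turns a vertex of the dual loop into an edge normal: every entry outside [us] lies between its
    neighbours. It is applied to (0,1), to obtain an edge of [Q] on the line y = 1. *)
Lemma loop_through_vertex us x : x \in loop_vertices (loop_through us) -> x \in us.
Proof.
case: (posnP (size us)) => [/size0nil ->|us0]; first by move/mem_loop_vertices=> [k []].
rewrite /loop_through; set L := flatten _.
have triL : inner_triples us L by apply: inner_triples_flatten => k; exact: cnth_mem.
have headL : head 0 L = cnth us 0.
  rewrite /L -[X in iota _ X](prednK us0).
  rewrite -[flatten _]/(lattice_segment (cnth us 0) (cnth us 1) ++ flatten _).
  by have [s [-> _]] := lattice_segment_ends (cnth us 0) (cnth us 1).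
have lastL : last 0 L = cnth us 0.
  rewrite /L -[X in iota _ X](prednK us0) -[X in iota _ X]addn1 iotaD map_cat flatten_cat last_cat.
  have -> n : flatten [seq lattice_segment (cnth us k) (cnth us k.+1) | k <- iota n 1] =
      lattice_segment (cnth us n) (cnth us n.+1) by rewrite -[RHS]cats0.
  rewrite add0n prednK //.
  have [s [-> /= ->]] := lattice_segment_ends (cnth us (size us).-1) (cnth us (size us)).
  by rewrite -[size us]add0n cnthD.
have c0 : cnth us 0 \in us by exact: cnth_mem.
have := inner_triples_squeeze triL.
have := head_squeeze L 0; have := last_squeeze L 0; rewrite headL lastL /cyclic_squeeze.
case: (squeeze L) => [//|h [|y t]] /=.
  move=> -> _ _ /mem_loop_vertices[k [_ _ ->]].
  by rewrite (_ : cnth _ _ = cnth us 0) // /cnth /= modn1.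
(* The squeezed list begins and ends with [cnth us 0], so its head is dropped and [ys] remains. The
   dropped head equals the last entry of [ys], so it still serves as the cyclic predecessor of the
   first one. *)
set ys := y :: t => hl hh tri; rewrite hh hl eqxx /= => /mem_loop_vertices[k [kn vk ->]].
have {}tri : inner_triples us (h :: ys) by [].
have szt : size ys = (size t).+1 by [].
case: (ltnP k.+1 (size ys)) => k1; last first.
  rewrite cnth_small // (_ : k = (size ys).-1); last by lia.
  by rewrite nth_last /= hl.
have := inner_triples_nth (i := k) tri; rewrite ltnS => /(_ k1).
have -> : (h :: ys)`_k = cnth ys (k + (size ys).-1).
  case: k {k1 vk} kn => [|k] kn.
    by rewrite add0n cnth_small // nth_last /= hl hh.
  by rewrite addSnnS prednK // cnthD cnth_small // ltnW.
rewrite -[(h :: ys)`_k.+1]/(ys`_k) -[(h :: ys)`_k.+2]/(ys`_k.+1) -!cnth_small // => -[//|[hu _ _]].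
by case: vk => [|/(_ hu)//]; lia.
Qed.

Lemma exists_normals s : reflexive_loop 1 s -> exists us,
  size us = size s /\ forall k, pairing (cnth us k) (cnth s k) = 1 /\
    pairing (cnth us k) (cnth s k.+1) = 1.
Proof.
move=> rs; have [s0 _ _] := rs.
(* The quarter turn of the step takes the value [cross x y] at both ends [x], [y]; this is 1 or -1,
   and the sign factor turns it into 1 whichever way the loop runs. *)
pose nrm k := cross (cnth s k) (cnth s k.+1) *: perp (cnth s k.+1 - cnth s k).
have nrmE k : pairing (nrm k) (cnth s k) = 1 /\ pairing (nrm k) (cnth s k.+1) = 1.
  have [_ + _] := reflexive_loop_steps rs k; rewrite /nrm.
  set x := cnth s k; set y := cnth s k.+1; set c := cross x y => c1.
  have cc : c * c = 1 by have : c = 1 \/ c = -1 by [lia]; case=> ->.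
  rewrite !pairing_perp -cc.
  by split; congr (_ * _); rewrite /c /cross !mxE; ring.
exists [seq nrm k | k <- iota 0 (size s)]; rewrite size_map size_iota; split=> // k.
rewrite -(cnth_mod s k) -(cnth_succ_mod s k) -(cnth_mod _ k) size_map size_iota.
have kn : (k %% size s < size s)%N by rewrite ltn_pmod.
by rewrite cnth_small ?size_map ?size_iota // (nth_map 0%N) ?size_iota // nth_iota // add0n.
Qed.

(** Take the lexicographically largest end of a step that lies on the line. Were it no vertex, the
    equal steps around it would keep both neighbours on the line, and one of them would be
    larger. *)
Lemma exists_vertex_on_line l s (u : 'rV[int]_2) c w : reflexive_loop l s ->
  pairing u (cnth s w) = c -> pairing u (cnth s w.+1) = c ->
  exists2 v, v \in loop_vertices s & pairing u v = c.
Proof.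
move=> rs uw uw1; have [s0 _ _] := rs.
(* A neighbour on the line is required too: where an edge merely crosses the line there is a point
   of the line that need not be a vertex. *)
pose p k := (pairing u (cnth s k.+1) == c) &&
  ((pairing u (cnth s k) == c) || (pairing u (cnth s k.+2) == c)).
have cSm k : cnth s (k %% size s).+2 = cnth s k.+2.
  by rewrite /cnth -[(k %% _).+2]addn2 modnDml addn2.
have pm k : p (k %% size s)%N = p k.
  by rewrite /p cnth_mod cnth_succ_mod cSm.
have inS k : p k -> (k %% size s)%N \in [seq k <- iota 0 (size s) | p k].
  by move=> pk; rewrite mem_filter mem_iota pm pk /= ltn_pmod.
have [|k kS kmax] := @lexle_max _ (fun k => cnth s k.+1) [seq k <- iota 0 (size s) | p k].
  have /inS : p w by rewrite /p uw uw1 eqxx.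
  by case: (filter _ _).
have {}kmax j : p j -> lexle (cnth s j.+1) (cnth s k.+1).
  by move=> /inS/kmax; rewrite cnth_succ_mod.
move: kS; rewrite mem_filter => /andP[pk _].
have uk : pairing u (cnth s k.+1) = c by case/andP: pk => /eqP.
exists (cnth s k.+1) => //; apply: cnth_loop_vertices => //; apply: contrapT => nv.
have e := reflexive_loop_nonvertex rs nv.
have ue : pairing u (cnth s k.+2) + pairing u (cnth s k) = c + c.
  have := congr1 (pairing u) e; rewrite !pairingBr uk => {}e.
  by rewrite -(subrK c (pairing u (cnth s k.+2))) e; ring.
have [uk0 uk2] : pairing u (cnth s k) = c /\ pairing u (cnth s k.+2) = c.
  by case/andP: pk => _ /orP[] /eqP h; rewrite h in ue *; lia.
move: nv; rewrite is_vertexS // => /not_orP[_ /contrapT hu].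
case: (hull2_lexmax hu).
- have c1 : cnth s (k + (size s).-1).+1 = cnth s k by rewrite -addnS prednK // cnthD.
  have c2 : cnth s (k + (size s).-1).+2 = cnth s k.+1.
    by rewrite -addnS prednK // -addSn cnthD.
  have : p (k + (size s).-1)%N by rewrite /p c1 c2 uk0 uk eqxx orbT.
  by move/kmax; rewrite c1.
- by apply: (kmax k.+1); rewrite /p uk2 uk !eqxx.
- exact: (reflexive_loop_neq rs).
- by move/esym; exact: (reflexive_loop_neq (k := k.+1) rs).
Qed.

(** * The loop case *)

(** The lexicographically largest normal [u] gives a vertex of the dual, and its line carries a
    vertex [v] of [Q]. The basis change adapted to the pair moves points by [U] and normals by the
    inverse transpose. *)
Lemma loop_normalization Q : reflexive_loop 1 Q ->
  exists Q', [/\ reflexive_loop 1 Q', loop_iso Q Q' & normalized_loop Q'].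
Proof.
move=> rQ; have [Q0 _ _] := rQ.
have [us [sus usE]] := exists_normals rQ.
have [|u uus umax] := @lexle_max _ id us; first by rewrite -size_eq0 sus -lt0n.
have uw : cnth us (index u us) = u by rewrite cnth_small ?index_mem // nth_index.
have [e1 e2] := usE (index u us); rewrite uw in e1 e2.
have [v vQ uv] := exists_vertex_on_line rQ e1 e2.
have [U uU [vU uUT]] := exists_dual_basis uv.
have rQ' := reflexive_loop_mulmx (ltn0Sn 0) uU rQ.
pose W := invmx U^T.
have uUt : U^T \in unitmx by rewrite unitmx_tr.
exists [seq x *m U | x <- Q]; split=> //.
  by exists U => //; exists 0%N; rewrite rot0.
split.
  rewrite loop_vertices_mulmx ?unit_det_neq0 // -vU.
  exact: (map_f (fun x : 'rV[int]_2 => x *m U) vQ).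
exists (loop_through [seq u *m W | u <- us]).
  exists [seq u *m W | u <- us]; rewrite !size_map; split=> // k _.
  have [f1 f2] := usE k.
  have pE x : pairing (cnth us k *m W) (x *m U) = pairing (cnth us k) x.
    by rewrite pairing_mulmx mulmxKV.
  rewrite !cnth_mulmx !pE; split=> //.
  by apply/primitiveP; exists (cnth Q k *m U); rewrite pairingC pE.
have -> : row2 0 1 = u *m W by rewrite -uUT mulmxK.
apply: (loop_through_extreme (G := U^T)); first exact: unit_det_neq0.
  exact: (map_f (fun x : 'rV[int]_2 => x *m W) uus).
by move=> _ /mapP[u' u's ->]; rewrite !mulmxKV //; exact: umax.
Qed.

Lemma loop_classification R : representatives (reflexive_loop 1) loop_iso R ->
  (forall Q, R Q -> normalized_loop Q) ->
  forall l P, (2 <= l)%N -> reflexive_loop l P ->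
  exists Q, R Q /\ exists i : nat, [/\ (0 < i < l)%N, coprime i l
    & loop_iso P (loop_image (mx22 l%:Z i%:Z 0 1) Q)].
Proof.
move=> [_ repR _] nR l P l2 rP; have [P0 _ _] := rP.
have l0 : (0 < l)%N by lia.
pose B := rows2 (cnth P 0) (cnth P 1).
have dB : `|\det B|%N = l by rewrite det_rows2; have [] := reflexive_loop_steps rP 0.
have [|q PE] := @seq_preim _ _ (fun x : 'rV[int]_2 => x *m B) P.
  move=> y yP; have [x e] := loop_lattice rP (index y P); exists x.
  by rewrite -e cnth_small ?index_mem // nth_index.
have rq : reflexive_loop 1 q by apply: (reflexive_loop_div l0 dB); rewrite -PE.
have [Q RQ [U uU [n qQ]]] := repR q rq.
exists Q; split=> //.
pose C := invmx U *m B.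
have PC : P = rot n [seq x *m C | x <- Q].
  rewrite -map_rot -qQ -map_comp PE; apply/eq_in_map => x _ /=.
  by rewrite /C mulmxA mulmxK.
have dC : `|\det C|%N = l.
  by rewrite det_mulmx abszM unit_det ?unitmx_inv // mul1n.
(* A rotation by more than the length is the identity, so [n] may be taken within range. *)
have {n qQ PC} [n nQ PC] : exists2 n, (n <= size Q)%N & P = rot n [seq x *m C | x <- Q].
  case: (leqP n (size Q)) => nQ; first by exists n.
  exists 0%N => //; rewrite rot0 PC rot_oversize // size_map; exact: ltnW.
have rQC : reflexive_loop l [seq x *m C | x <- Q].
  by apply: (@reflexive_loop_rot _ _ n); rewrite ?size_map // -PC.
have dC0 : \det C != 0 by lia.
have [vQ [ys [us [sus usE ->]] /loop_through_vertex uus]] := nR _ RQ.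
have pv : primitive (row2 0 1 *m C).
  have := map_f (fun x : 'rV[int]_2 => x *m C) vQ.
  rewrite -loop_vertices_mulmx // => /mem_loop_vertices[k [_ vk ->]].
  by have [_ _] := reflexive_loop_steps rQC k; exact.
have [V [i [uV il CV]]] := hermite_normal_form l0 dC pv.
have rQA := reflexive_loop_mulmx l0 uV rQC.
rewrite -map_comp in rQA.
have QAE : map ((mulmx^~ V) \o (mulmx^~ C)) Q = [seq x *m mx22 l%:Z i%:Z 0 1 | x <- Q].
  by apply/eq_in_map => x _ /=; rewrite -mulmxA CV.
have {}rQA : reflexive_loop l [seq x *m mx22 l%:Z i%:Z 0 1 | x <- Q] by rewrite -QAE.
(* At the index of the normal (0,1) both ends of the step have second coordinate 1. The step is thus
   (z,0), with image z(l,i), and coprimality comes from primitivity of this image step. *)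
have cil : coprime i l.
  have kn : (index (row2 0 1) us < size Q)%N by rewrite -sus index_mem.
  have [_ + +] := usE _ kn; rewrite [cnth us _]cnth_small ?sus // nth_index //.
  set k := index _ _; rewrite !pairingE row2E0 row2E1 !mul0r !add0r !mul1r => h1 h2.
  have [pk _ _] := reflexive_loop_steps rQA k; move: pk.
  rewrite !cnth_mulmx -mulmxBl => /primitiveP[u].
  set z := cnth Q k.+1 - cnth Q k.
  have z1 : z 0 1 = 0 by rewrite !mxE h1 h2 subrr.
  rewrite pairingE !mulmx2E !mx22E z1 !mul0r !addr0 => e.
  rewrite /coprime -dvdn1.
  have : (1 : int) \in dvdz (gcdn i l).
    rewrite -e rpredD // dvdz_mull // dvdz_mull // dvdzE /= ?dvdn_gcdl ?dvdn_gcdr //.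
  by rewrite dvdzE.
exists i; split=> //.
  rewrite il andbT lt0n; apply/eqP => i0; move: cil; rewrite i0 /coprime gcd0n; lia.
have dA0 : \det (mx22 l%:Z i%:Z 0 1) != 0 by rewrite det22 !mx22E; lia.
have [m mQ lE] := loop_through_loop_vertices rQA.
rewrite size_map in mQ.
exists V => //; rewrite /loop_image -loop_vertices_mulmx // lE PC map_rot -map_comp QAE.
(* Undo the rotation by [m] introduced in rebuilding the loop, then apply the rotation by [n] that
   relates [P] to [Q]. *)
set S := [seq _ | _ <- Q]; exists (rot_add (rot m S) (size (rot m S) - m) n).
by rewrite -rot_rot_add -[rot (_ - m) _]/(rotr m _) rotK.
Qed.

(** * Convex hulls and extreme points *)

Lemma hull_nil z : ~ hull [::] z.
Proof. by case=> c [_ + _]; rewrite big_ord0 => /eqP; rewrite eq_sym oner_eq0. Qed.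

Lemma hull_cons a s z : hull (a :: s) z ->
  z = toQ a \/ exists t y, [/\ 0 <= t <= 1, hull s y & z = t *: toQ a + (1 - t) *: y].
Proof.
case=> c [c0 c1 ->]; rewrite !big_ord_recl /= in c1 *.
set t := c ord0 in c1 *; set S := \sum_(i < size s) c (lift ord0 i) in c1.
have t0 : 0 <= t by exact: c0.
have S0 : 0 <= S by apply: sumr_ge0 => i _; exact: c0.
have [Sz|Sz] := eqVneq S 0.
  left; have t1 : t = 1 by lra.
  rewrite t1 scale1r big1 ?addr0 // => i _.
  have /eqP : c (lift ord0 i) = 0.
    apply/eqP; move/eqP: Sz; rewrite psumr_eq0 => [/allP/(_ i)|j _]; last exact: c0.
    by rewrite mem_index_enum; exact.
  by move/eqP=> ->; rewrite scale0r.
right; exists t; exists (\sum_(i < size s) (c (lift ord0 i) / S) *: toQ s`_i).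
have tS : 1 - t = S by lra.
split; first by lra.
  exists (fun i => c (lift ord0 i) / S); split=> //.
    by move=> i; rewrite divr_ge0.
  by rewrite -mulr_suml divff.
rewrite tS scaler_sumr; congr (_ + _); apply: eq_bigr => i _.
by rewrite scalerA mulrC divfK.
Qed.

Definition convex_set (C : set 'rV[rat]_2) : Prop :=
  forall x y t, C x -> C y -> 0 <= t <= 1 -> C (t *: x + (1 - t) *: y).

(** Minimality of the hull among convex sets, used as an induction principle in place of explicit
    weights. *)
Lemma hull_ind s (C : set 'rV[rat]_2) : (forall v, v \in s -> C (toQ v)) ->
  convex_set C -> forall z, hull s z -> C z.
Proof.
elim: s => [|a s IH] Cs cC z; first by move/hull_nil.
move/hull_cons=> [->|[t [y [t01 hy ->]]]]; first by apply: Cs; rewrite mem_head.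
apply: (cC) => //; first by apply: (Cs); rewrite mem_head.
by apply: IH => // v vs; apply: Cs; rewrite inE vs orbT.
Qed.

Lemma hull_convex s : convex_set (hull s).
Proof.
move=> x y t [c [c0 c1 ->]] [d [d0 d1 ->]] t01.
exists (fun i => t * c i + (1 - t) * d i); split=> [i||].
- by rewrite addr_ge0 // mulr_ge0 ?c0 ?d0 //; lra.
- by rewrite big_split /= -!mulr_sumr c1 d1; ring.
- rewrite !scaler_sumr -big_split /=; apply: eq_bigr => i _.
  by rewrite [RHS]scalerDl !scalerA.
Qed.

Lemma hull_mem s v : v \in s -> hull s (toQ v).
Proof.
rewrite -index_mem => vs; have vi := nth_index 0 (etrans (esym (index_mem v s)) vs).
exists (fun i => (i == Ordinal vs)%:R); split=> [i||].
- by rewrite ler0n.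
- by rewrite -[RHS](@big_pred1_eq _ 0 +%R _ (Ordinal vs) (fun=> 1)) [RHS]big_mkcond; apply: eq_bigr => i _; case: (i == _).
- rewrite (bigD1 (Ordinal vs)) //= eqxx scale1r vi big1 ?addr0 // => i /negbTE ->.
  by rewrite scale0r.
Qed.

Lemma convex_halfspace (u : 'rV[rat]_2) c : convex_set (fun x => pairing u x <= c).
Proof.
move=> x y t ux uy t01; rewrite !pairingE !mxE in ux uy *.
set p := u 0 0 * x 0 0 + u 0 1 * x 0 1 in ux; set q := u 0 0 * y 0 0 + u 0 1 * y 0 1 in uy.
have -> : u 0 0 * (t * x 0 0 + (1 - t) * y 0 0) + u 0 1 * (t * x 0 1 + (1 - t) * y 0 1)
  = t * p + (1 - t) * q by rewrite /p /q; ring.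
have h1 : t * p <= t * c by rewrite ler_wpM2l //; lra.
have h2 : (1 - t) * q <= (1 - t) * c by rewrite ler_wpM2l //; lra.
lra.
Qed.

Lemma hull_le s (u : 'rV[rat]_2) c : (forall v, v \in s -> pairing u (toQ v) <= c) ->
  forall z, hull s z -> pairing u z <= c.
Proof. by move=> h; apply: hull_ind => //; exact: convex_halfspace. Qed.

Lemma hull_sub s s' : {subset s <= s'} -> forall z, hull s z -> hull s' z.
Proof.
move=> ss; apply: hull_ind => [v vs|]; last exact: hull_convex.
exact/hull_mem/ss.
Qed.

Lemma vertex_of_hull s z : vertices (hull s) z -> exists2 v, v \in s & z = toQ v.
Proof.
elim: s z => [|a s IH] z [hz ext]; first by case: (hull_nil hz).
have sub y : hull s y -> hull (a :: s) y.
  by apply: hull_sub => x xs; rewrite inE xs orbT.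
have ha : hull (a :: s) (toQ a) by apply: hull_mem; rewrite mem_head.
case: (hull_cons hz) => [->|[t [y [t01 hy zE]]]]; first by exists a; rewrite ?mem_head.
have [t0|t0] := eqVneq t 0.
  have zy : z = y by rewrite zE t0 scale0r subr0 scale1r add0r.
  have [v vs ->] : exists2 v, v \in s & z = toQ v.
    apply: IH; split; first by rewrite zy.
    by move=> x x' t' /sub hx /sub hx'; exact: ext.
  by exists v; rewrite // inE vs orbT.
have [t1|t1] := eqVneq t 1.
  by exists a; rewrite ?mem_head // zE t1 subrr scale0r scale1r addr0.
have [|<- _] := ext _ _ t ha (sub _ hy) _ zE; first by lra.
by exists a; rewrite ?mem_head.
Qed.

(* A point of [s] that is not extreme is a convex combination of the others, so it
   can be dropped without changing the hull. *)
Lemma hull_vertices s : exists vs,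
  hull vs = hull s /\ forall v, v \in vs -> vertices (hull s) (toQ v).
Proof.
have [n] := ubnP (size s); elim: n s => [//|n IH] s sn.
case: (pselect (forall v, v \in s -> vertices (hull s) (toQ v))) => [h|]; first by exists s.
move=> /existsNP[v /not_implyP[vs nv]].
have [x [y [t [hx hy t01 vE nxy]]]] : exists x y t, [/\ hull s x, hull s y, 0 < t < 1,
    toQ v = t *: x + (1 - t) *: y & ~ (x = toQ v /\ y = toQ v)].
  apply: contrapT => h; apply: nv; split; first exact: hull_mem.
  move=> x y t hx hy t01 e; apply: contrapT => nxy.
  by apply: h; exists x, y, t.
pose s' := [seq w <- s | w != v].
have hs' w : hull s w -> w = toQ v \/
    exists t y, [/\ 0 <= t <= 1, hull s' y & w = t *: toQ v + (1 - t) *: y].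
  move=> hw; apply: hull_cons; apply: hull_sub hw => z zs.
  by rewrite inE mem_filter zs andbT orbN.
have hv : hull s' (toQ v).
  have vj j : toQ v 0 j = t * x 0 j + (1 - t) * y 0 j by rewrite vE !mxE.
  case: (hs' x hx) => [xv|[a [x' [a01 hx' xE]]]].
    case: nxy; split=> //; apply/rowP=> j; have := vj j; rewrite xv => e.
    have t1 : 1 - t != 0 by lra.
    by apply: (mulfI t1); lra.
  case: (hs' y hy) => [yv|[b [y' [b01 hy' yE]]]].
    case: nxy; split=> //; apply/rowP=> j; have := vj j; rewrite yv => e.
    have t1 : t != 0 by lra.
    by apply: (mulfI t1); lra.
  (* Substituting the expressions of [x] and [y] through [v] into that of [v] leaves the weights [r]
     and [r'] on points of the smaller hull. If both vanish then x = y = v; otherwise one divides by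
     their sum. *)
  pose r := t * (1 - a); pose r' := (1 - t) * (1 - b).
  have r0 : 0 <= r by rewrite mulr_ge0; lra.
  have r0' : 0 <= r' by rewrite mulr_ge0; lra.
  have rv j : (r + r') * toQ v 0 j = r * x' 0 j + r' * y' 0 j.
    have xj : x 0 j = a * toQ v 0 j + (1 - a) * x' 0 j by rewrite xE !mxE.
    have yj : y 0 j = b * toQ v 0 j + (1 - b) * y' 0 j by rewrite yE !mxE.
    have -> : (r + r') * toQ v 0 j = toQ v 0 j - (t * a + (1 - t) * b) * toQ v 0 j.
      by rewrite /r /r'; ring.
    by rewrite {1}(vj j) xj yj /r /r'; ring.
  have [rr|rr] := eqVneq (r + r') 0.
    have rz : r = 0 by lra.
    have rz' : r' = 0 by lra.
    have a1 : 1 - a = 0.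
      by apply: (@mulfI _ t); [lra|rewrite mulr0].
    have b1 : 1 - b = 0.
      by apply: (@mulfI _ (1 - t)); [lra|rewrite mulr0].
    case: nxy; rewrite xE yE a1 b1 !scale0r !addr0.
    have -> : a = 1 by lra.
    have -> : b = 1 by lra.
    by rewrite scale1r.
  have -> : toQ v = (r / (r + r')) *: x' + (1 - r / (r + r')) *: y'.
    apply/rowP=> j; apply: (mulfI rr); rewrite rv !mxE.
    by field.
  apply: hull_convex => //.
  by rewrite divr_ge0 ?addr_ge0 //= ler_pdivrMr ?mul1r; lra.
have e : hull s' = hull s.
  apply/seteqP; split=> z; first by apply: hull_sub => w; rewrite mem_filter => /andP[].
  apply: hull_ind; last exact: hull_convex.
  move=> w ws; have [->//|wv] := eqVneq w v.
  by apply: hull_mem; rewrite mem_filter wv.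
have [|vs' h] := IH s'.
  rewrite size_filter -(count_predC (fun w => w != v) s) in sn *.
  have : (0 < count (predC (fun w => w != v)) s)%N.
    by rewrite -has_count; apply/hasP; exists v => //=; rewrite eqxx.
  by move: sn; rewrite ltnS => sn h; apply: leq_trans sn; rewrite -addn1 leq_add2l.
by exists vs'; rewrite -e.
Qed.

Lemma crossxx (T : comPzRingType) (x : 'rV[T]_2) : cross x x = 0.
Proof. by rewrite /cross; ring. Qed.

(** Equivalently, [D] lies in an open half-plane bounded by a line through 0. Three vectors suffice
    in the plane by Caratheodory's theorem. *)
Definition no_opposite (D : seq 'rV[rat]_2) : Prop :=
  forall a b c, a \in D -> b \in D -> c \in D ->
  forall x y z : rat, 0 <= x -> 0 <= y -> 0 <= z ->
  x *: a + y *: b + z *: c = 0 -> [/\ x = 0, y = 0 & z = 0].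

(** Insertion of [d] into the list: either the old extreme [w] survives or [d] replaces it, and a
    third vector beyond [d] would close up a positive relation. The sign [sg] selects the side. *)
Lemma extreme_direction (D : seq 'rV[rat]_2) (sg : rat) : D != [::] -> no_opposite D ->
  exists2 w, w \in D & forall d, d \in D -> 0 <= sg * cross w d.
Proof.
elim: D => [//|d [|e D] IH] _ nD.
  by exists d => [|x]; rewrite ?mem_head // inE => /eqP->; rewrite crossxx mulr0.
have [//||w wD h] := IH.
  by move=> a b c aD bD cD; apply: nD; rewrite inE ?aD ?bD ?cD orbT.
case: (lerP 0 (sg * cross w d)) => wd.
  by exists w => [|x]; rewrite inE ?wD ?orbT // => /orP[/eqP->|/h].
exists d => [|x]; first exact: mem_head.
rewrite inE => /orP[/eqP->|xD]; first by rewrite crossxx mulr0.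
case: lerP => // dx; have wx := h _ xD.
have dw : 0 <= sg * cross d w by move: wd; rewrite /cross; lra.
have xd : 0 <= sg * cross x d by move: dx; rewrite /cross; lra.
have wD' : w \in d :: e :: D by rewrite inE wD orbT.
have xD' : x \in d :: e :: D by rewrite inE xD orbT.
(* The linear relation between three plane vectors; all its coefficients are nonnegative here and
   the middle one is positive. *)
have e0 : (sg * cross w x) *: d + (sg * cross x d) *: w + (sg * cross d w) *: x = 0.
  by apply: rv2P; rewrite !mxE /cross; ring.
have [_ e1 _] := nD d w x (mem_head _ _) wD' xD' _ _ _ wx xd dw e0.
by move: dx; rewrite /cross in e1 *; lra.
Qed.

(** A relation with x > 0 writes [v] either as [a] itself or as a point strictly between [a] and a
    point of the hull; extremality then gives a = v. *)
Lemma vertex_no_opposite vs v : vertices (hull vs) (toQ v) ->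
  no_opposite [seq toQ w - toQ v | w <- vs & w != v].
Proof.
move=> [hv ext].
have pos a b c x y z : a \in vs -> a != v -> b \in vs -> c \in vs ->
    0 <= x -> 0 <= y -> 0 <= z ->
    x *: (toQ a - toQ v) + y *: (toQ b - toQ v) + z *: (toQ c - toQ v) = 0 -> x = 0.
  move=> avs av bvs cvs x0 y0 z0 e; apply/eqP; apply: contraT => xn.
  case/eqP: av; apply: toQ_inj.
  have ej j : (x + y + z) * toQ v 0 j = x * toQ a 0 j + y * toQ b 0 j + z * toQ c 0 j.
    have := congr1 (fun m : 'rV_2 => m 0 j) e.
    rewrite !mxE => {}e; rewrite -[RHS]subr0 -[X in _ - X]e; ring.
  have xp : 0 < x by rewrite lt_neqAle eq_sym xn.
  have [yz|yz] := eqVneq (y + z) 0.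
    have y00 : y = 0 by lra.
    have z00 : z = 0 by lra.
    by apply/rowP=> j; apply: (mulfI xn); have := ej j; rewrite y00 z00; lra.
  have yzp : 0 < y + z by rewrite lt_neqAle eq_sym yz addr_ge0.
  have yzx : x + y + z != 0 by lra.
  have hy : hull vs ((y / (y + z)) *: toQ b + (1 - y / (y + z)) *: toQ c).
    apply: hull_convex; [exact: hull_mem|exact: hull_mem|].
    by apply/andP; split; [rewrite divr_ge0 // ltW|rewrite ler_pdivrMr // mul1r; lra].
  have xyzp : 0 < x + y + z by lra.
  have [|| //] := ext _ _ (x / (x + y + z)) (hull_mem avs) hy.
    by apply/andP; split; [exact: divr_gt0|rewrite ltr_pdivrMr // mul1r; lra].
  apply/rowP=> j; apply: (mulfI yzx); rewrite ej !mxE.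
  by field; rewrite yzx yz.
move=> _ _ _ /mapP[a + ->] /mapP[b + ->] /mapP[c + ->].
rewrite !mem_filter => /andP[av avs] /andP[bv bvs] /andP[cv cvs] x y z x0 y0 z0 e.
split; first exact: (pos a b c x y z).
  by apply: (pos b a c y x z) => //; rewrite (addrC (y *: _)).
by apply: (pos c a b z x y) => //; rewrite -addrA addrC.
Qed.

Lemma origin_interior_functional P (u : 'rV[rat]_2) : origin_interior P ->
  (forall x, P x -> pairing u x <= 0) -> u = 0.
Proof.
move=> [e e0 he] h.
have hj (a b : rat) : `|a| <= e -> `|b| <= e -> u 0 0 * a + u 0 1 * b <= 0.
  move=> ae be; have := h (row2 a b); rewrite pairingE row2E0 row2E1; apply.
  by apply: he => j; case: (ord2P j) => ->; rewrite ?row2E0 ?row2E1.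
have ee : `|e| <= e by rewrite gtr0_norm.
have ne : `|-e| <= e by rewrite normrN.
have ze : `|0 : rat| <= e by rewrite normr0 ltW.
have := hj e 0 ee ze; have := hj (-e) 0 ne ze; have := hj 0 e ze ee; have := hj 0 (-e) ze ne.
move=> h1 h2 h3 h4; apply: rv2P; rewrite mxE.
  by apply: (@mulIf _ e); [lra|rewrite mul0r; lra].
by apply: (@mulIf _ e); [lra|rewrite mul0r; lra].
Qed.

Lemma origin_in P : origin_interior P -> P 0.
Proof. by move=> [e e0 h]; apply: h => j; rewrite mxE normr0 ltW. Qed.

Lemma pairing_perp1 (e x : 'rV[rat]_2) : pairing (perp e) x = cross x e.
Proof. by rewrite -[perp e]scale1r pairing_perp mul1r. Qed.

(* The two neighbours of [v] come from the extreme directions [w - v]: these all lie in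
   an open half-plane since [v] is extreme. *)
Lemma vertex_cone vs v : vertices (hull vs) (toQ v) -> origin_interior (hull vs) ->
  exists w1 w2, [/\ w1 \in vs, w2 \in vs,
    0 < cross (toQ w1 - toQ v) (toQ w2 - toQ v),
    forall x, hull vs x -> 0 <= cross (toQ w1 - toQ v) (x - toQ v)
  & forall x, hull vs x -> 0 <= cross (x - toQ v) (toQ w2 - toQ v)].
Proof.
move=> vv int; have nD := vertex_no_opposite vv.
set D := map _ _ in nD.
have D0 : D != [::].
  apply/eqP => D0.
  have vsv w : w \in vs -> w = v.
    move=> ws; apply/eqP; apply: contraT => wv.
    have : toQ w - toQ v \in D by apply: map_f; rewrite mem_filter wv.
    by rewrite D0.
  have aux (u : 'rV[rat]_2) : u = 0.
    have hc c : pairing u (toQ v) <= c -> forall z, hull vs z -> pairing u z <= c.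
      by move=> hc; apply: hull_le => w /vsv ->.
    apply: (origin_interior_functional int) => x hx.
    have c0 : pairing (- u) 0 <= pairing (- u) (toQ v).
      by apply: (@hull_le vs) (origin_in int) => w /vsv ->.
    apply: hc hx; move: c0; rewrite !pairingE !mxE; lra.
  have /rowP/(_ 0) := aux (row2 1 0); rewrite row2E0 mxE; lra.
have inD w : w \in vs -> w != v -> toQ w - toQ v \in D.
  by move=> ws wv; apply: map_f; rewrite mem_filter wv.
have ofD d : d \in D -> exists2 w, w \in vs & d = toQ w - toQ v.
  by move=> /mapP[w]; rewrite mem_filter => /andP[_ ws] ->; exists w.
have [d1 d1D h1] := extreme_direction 1 D0 nD.
have [d2 d2D h2] := extreme_direction (-1) D0 nD.
have [w1 w1s d1E] := ofD _ d1D; have [w2 w2s d2E] := ofD _ d2D.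
have H1 x : hull vs x -> 0 <= cross d1 (x - toQ v).
  move=> hx; have := @hull_le vs (perp d1) (cross (toQ v) d1) _ x hx.
  rewrite pairing_perp1 => h; have {h} : cross x d1 <= cross (toQ v) d1.
    apply: h => w ws; rewrite pairing_perp1; have [->//|wv] := eqVneq w v.
    by have := h1 _ (inD _ ws wv); rewrite /cross !mxE; lra.
  by rewrite /cross !mxE; lra.
have H2 x : hull vs x -> 0 <= cross (x - toQ v) d2.
  move=> hx; have := @hull_le vs (- perp d2) (- cross (toQ v) d2) _ x hx.
  have pN y : pairing (- perp d2) y = - cross y d2.
    by rewrite -pairing_perp1 !pairingE !mxE; ring.
  rewrite pN => h; have {h} : - cross x d2 <= - cross (toQ v) d2.
    apply: h => w ws; rewrite pN; have [->//|wv] := eqVneq w v.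
    by have := h2 _ (inD _ ws wv); rewrite /cross !mxE; lra.
  by rewrite /cross !mxE; lra.
exists w1, w2; rewrite -d1E -d2E; split=> //.
have := h1 _ d2D; rewrite mul1r le_eqVlt => /orP[/eqP c0|//].
(* Otherwise all points lie on a line through [v]. *)
have d1n : d1 != 0.
  apply/eqP=> d10; have [] := nD d1 d1 d1 d1D d1D d1D 1 0 0; rewrite ?d10 ?lexx ?ler01 //.
  by rewrite !scaler0 !addr0.
pose n := d1 0 0 * d1 0 0 + d1 0 1 * d1 0 1; pose q := d1 0 0 * d2 0 0 + d1 0 1 * d2 0 1.
have n0 : 0 <= n by rewrite addr_ge0 // -expr2 sqr_ge0.
have nn : n != 0.
  apply: contra d1n; rewrite /n paddr_eq0 -?expr2 ?sqr_ge0 // !sqrf_eq0 => /andP[/eqP a /eqP b].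
  by apply/eqP; apply: rv2P; rewrite mxE.
have dE : n *: d2 = q *: d1.
  have e0 : cross d1 d2 = 0 by [].
  apply: rv2P; rewrite !mxE /n /q.
    transitivity ((d1 0 0 * d2 0 0 + d1 0 1 * d2 0 1) * d1 0 0 - d1 0 1 * cross d1 d2).
      by rewrite /cross; ring.
    by rewrite e0 mulr0 subr0.
  transitivity ((d1 0 0 * d2 0 0 + d1 0 1 * d2 0 1) * d1 0 1 + d1 0 0 * cross d1 d2).
    by rewrite /cross; ring.
  by rewrite e0 mulr0 addr0.
(* For q <= 0 the directions are opposite, which extremality of [v] forbids. For q > 0 the two
   half-plane conditions are opposite, and the hull lies on one line although the origin is
   interior. *)
case: (lerP q 0) => q0.
  have [] := nD d2 d1 d1 d2D d1D d1D n (- q) 0 n0 _ (lexx 0); first by lra.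
    by rewrite dE scaleNr subrr scale0r addr0.
  by move=> nz; rewrite nz eqxx in nn.
have flat x : hull vs x -> cross x d1 = cross (toQ v) d1.
  move=> hx; have a := H1 x hx; have b := H2 x hx.
  have : n * cross (x - toQ v) d2 = q * cross (x - toQ v) d1.
    have d2j j : n * d2 0 j = q * d1 0 j.
      by have := congr1 (fun m : 'rV_2 => m 0 j) dE; rewrite !mxE.
    by rewrite /cross !mulrBr !(mulrCA n) !(mulrCA q) !d2j.
  have : 0 <= n * cross (x - toQ v) d2 by rewrite mulr_ge0.
  move=> + e; rewrite e pmulr_rge0 // => {}b.
  by move: a b; rewrite /cross !mxE; lra.
have p0 : perp d1 = 0.
  apply: (origin_interior_functional int) => x hx.
  by rewrite pairing_perp1 flat // -(flat 0 (origin_in int)) /cross !mxE !mul0r subrr.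
case/eqP: d1n; apply: rv2P; rewrite mxE.
  by have /rowP/(_ 1) := p0; rewrite row2E1 mxE; lra.
by have /rowP/(_ 0) := p0; rewrite row2E0 mxE.
Qed.

(** * Edges and vertices of reflexive polygons *)

Definition supporting (l : nat) (P : set 'rV[rat]_2) (g : 'rV[int]_2) : Prop :=
  primitive g /\ forall z, P z -> pairing (toQ g) z <= l%:R.

(** Trades any functional whose maximum is attained at two points for the primitive integral normal
    of the same edge, at height l. *)
Lemma edge_normal l P (u : 'rV[rat]_2) c x y : reflexive_polygon l P -> u <> 0 ->
  (forall z, P z -> pairing u z <= c) -> P x -> P y -> x <> y ->
  pairing u x = c -> pairing u y = c ->
  exists g, supporting l P g /\
    forall z, P z -> (pairing u z = c <-> pairing (toQ g) z = l%:R).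
Proof.
move=> [_ _ _ h] u0 uP Px Py xy ux uy.
have [|_ [g [pg [c' gP FE]] FE']] := h [set z | P z /\ pairing u z = c]%classic.
  split; first by exists u => //; exists c.
  by exists x, y.
have F z : P z /\ pairing u z = c <-> P z /\ pairing (toQ g) z = c'.
  by have := congr1 (fun S => S z) FE; rewrite /= => ->.
have F' z : P z /\ pairing u z = c <-> P z /\ pairing (toQ g) z = l%:R.
  by have := congr1 (fun S => S z) FE'; rewrite /= => ->.
(* The face description and the local index each give a height for the same normal; evaluating at
   [x] shows that the two agree. *)
have c'l : c' = l%:R.
  by have [_ <-] := (F x).1 (conj Px ux); have [_ ->] := (F' x).1 (conj Px ux).
exists g; split; first by split=> // z Pz; rewrite -c'l gP.
move=> z Pz; split=> hz; first by have [] := (F' z).1 (conj Pz hz).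
by have [] := (F' z).2 (conj Pz hz).
Qed.

Definition spans_polygon (vs : seq 'rV[int]_2) P : Prop :=
  P = hull vs /\ forall z, vertices P z <-> exists2 v, v \in vs & z = toQ v.

Lemma polygon_vertices P : lattice_polytope P -> exists vs, spans_polygon vs P.
Proof.
move=> [s ->]; have [vs [e h]] := hull_vertices s; exists vs; split; first by rewrite e.
move=> z; split=> [hz|[v vv ->]]; last exact: h.
by apply: vertex_of_hull; rewrite e.
Qed.

Lemma natr_intr l : l%:R = (l%:Z)%:~R :> rat.
Proof. by rewrite pmulrn. Qed.

Lemma cross_pairing_eq0 (u a b : 'rV[rat]_2) : cross a b != 0 ->
  pairing u a = 0 -> pairing u b = 0 -> u = 0.
Proof.
rewrite /cross !pairingE => c0 ha hb; apply: rv2P; rewrite mxE; apply: (mulfI c0); rewrite mulr0.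
  transitivity ((u 0 0 * a 0 0 + u 0 1 * a 0 1) * b 0 1
    - (u 0 0 * b 0 0 + u 0 1 * b 0 1) * a 0 1); first by ring.
  by rewrite ha hb !mul0r subrr.
transitivity ((u 0 0 * b 0 0 + u 0 1 * b 0 1) * a 0 0
    - (u 0 0 * a 0 0 + u 0 1 * a 0 1) * b 0 0); first by ring.
by rewrite ha hb !mul0r subrr.
Qed.

Lemma primitive_toQ g : primitive g -> toQ g <> 0.
Proof.
move=> [g0 _] e; apply: g0; apply: toQ_inj; rewrite e.
by apply/rowP=> j; rewrite !mxE.
Qed.

Definition on_edge l P g (v w : 'rV[int]_2) : Prop :=
  [/\ supporting l P g, pairing g v = l%:Z, pairing g w = l%:Z & w <> v].

(** The last clause says that the tangent cone at [v] is generated by the two edge directions. It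
    allows values at the neighbours to be compared with values on all of [P]. *)
Lemma vertex_neighbours l P vs v : reflexive_polygon l P -> spans_polygon vs P ->
  v \in vs -> exists g1 w1 g2 w2,
  [/\ w1 \in vs, w2 \in vs, on_edge l P g1 v w1, on_edge l P g2 v w2
    & forall d : 'rV[rat]_2, pairing (toQ g1) d <= 0 -> pairing (toQ g2) d <= 0 ->
      exists a b, [/\ 0 <= a, 0 <= b &
        d = a *: (toQ w1 - toQ v) + b *: (toQ w2 - toQ v)]].
Proof.
move=> rP [PE hv] vvs; have [_ oP _ _] := rP.
have vv : vertices (hull vs) (toQ v) by rewrite -PE; apply/hv; exists v.
rewrite PE in oP.
have [w1 [w2 [w1s w2s X0 H1 H2]]] := vertex_cone vv oP.
rewrite -PE in H1 H2.
set d1 := toQ w1 - toQ v in X0 H1; set d2 := toQ w2 - toQ v in X0 H2.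
have [Pv Pw1 Pw2] : [/\ P (toQ v), P (toQ w1) & P (toQ w2)].
  by rewrite PE; split; exact: hull_mem.
have nz (d e : 'rV[rat]_2) : cross d e != 0 -> perp d <> 0 /\ perp e <> 0.
  have p0 (f : 'rV[rat]_2) : perp f = 0 -> f 0 0 = 0 /\ f 0 1 = 0.
    move=> /rowP pf; have := pf 0; have := pf 1; rewrite row2E0 row2E1 !mxE => /eqP.
    by rewrite oppr_eq0 => /eqP.
  move=> c0; split=> /p0[f0 f1]; move: c0; rewrite /cross f0 f1 ?mul0r ?mulr0 subrr eqxx //.
have [nz1 nz2] := nz _ _ (lt0r_neq0 X0).
have w1v : w1 <> v by move=> e; move: X0; rewrite /d1 e subrr /cross !mxE; lra.
have w2v : w2 <> v by move=> e; move: X0; rewrite /d2 e subrr /cross !mxE; lra.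
have [g1 [sg1 e1]] : exists g, supporting l P g /\
    forall z, P z -> (pairing (perp d1) z = cross (toQ v) d1 <-> pairing (toQ g) z = l%:R).
  apply: (edge_normal (x := toQ v) (y := toQ w1)) => //.
  - by move=> z /H1; rewrite pairing_perp1 /cross !mxE; lra.
  - by move/toQ_inj/esym.
  - by rewrite pairing_perp1.
  - by rewrite pairing_perp1 /d1 /cross !mxE; ring.
have pN y : pairing (- perp d2) y = - cross y d2.
  by rewrite -pairing_perp1 !pairingE !mxE; ring.
have [g2 [sg2 e2]] : exists g, supporting l P g /\
    forall z, P z -> (pairing (- perp d2) z = - cross (toQ v) d2 <-> pairing (toQ g) z = l%:R).
  apply: (edge_normal (x := toQ v) (y := toQ w2)) => //.
  - by move/eqP; rewrite oppr_eq0 => /eqP.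
  - by move=> z /H2; rewrite pN /cross !mxE; lra.
  - by move/toQ_inj/esym.
  - by rewrite pN /d2 /cross !mxE; ring.
have toint g w : pairing (toQ g) (toQ w) = l%:R -> pairing g w = l%:Z.
  by rewrite pairing_int natr_intr => /intr_inj.
have g1v := (e1 _ Pv).1 (pairing_perp1 _ _).
have g2v := (e2 _ Pv).1 (pN _).
have g1w : pairing (toQ g1) (toQ w1) = l%:R.
  by apply/(e1 _ Pw1); rewrite pairing_perp1 /d1 /cross !mxE; ring.
have g2w : pairing (toQ g2) (toQ w2) = l%:R.
  by apply/(e2 _ Pw2); rewrite pN /d2 /cross !mxE; ring.
exists g1, w1, g2, w2; split=> //.
- by split=> //; exact: toint.
- by split=> //; exact: toint.
have g11 : pairing (toQ g1) d1 = 0 by rewrite pairingBr g1w g1v subrr.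
have g22 : pairing (toQ g2) d2 = 0 by rewrite pairingBr g2w g2v subrr.
have X0n := lt0r_neq0 X0.
have g12 : pairing (toQ g1) d2 < 0.
  rewrite lt_neqAle; apply/andP; split.
    apply/eqP => z; have [pg _] := sg1.
    by case: (primitive_toQ pg); exact: cross_pairing_eq0 X0n g11 z.
  by rewrite pairingBr g1v subr_le0; have [_] := sg1; exact.
have g21 : pairing (toQ g2) d1 < 0.
  rewrite lt_neqAle; apply/andP; split.
    apply/eqP => z; have [pg _] := sg2.
    by case: (primitive_toQ pg); exact: cross_pairing_eq0 X0n z g22.
  by rewrite pairingBr g2v subr_le0; have [_] := sg2; exact.
(* Coefficients by Cramer's rule. Each is nonnegative because one normal vanishes on one edge
   direction and is negative on the other. *)
move=> d h1 h2; exists (cross d d2 / cross d1 d2), (cross d1 d / cross d1 d2).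
have lin (g : 'rV[rat]_2) : cross d1 d2 * pairing g d =
    cross d d2 * pairing g d1 + cross d1 d * pairing g d2.
  by rewrite !pairingE /cross; ring.
split.
- rewrite divr_ge0 ?(ltW X0) //; have := lin (toQ g2); rewrite g22 mulr0 addr0 => e.
  have : cross d d2 * pairing (toQ g2) d1 <= 0 by rewrite -e pmulr_rle0.
  by rewrite nmulr_lle0.
- rewrite divr_ge0 ?(ltW X0) //; have := lin (toQ g1); rewrite g11 mulr0 add0r => e.
  have : cross d1 d * pairing (toQ g1) d2 <= 0 by rewrite -e pmulr_rle0.
  by rewrite nmulr_lle0.
- rewrite -/d1 -/d2; clearbody d1 d2; apply/rowP=> j; rewrite !mxE.
  transitivity ((cross d d2 * d1 0 j + cross d1 d * d2 0 j) / cross d1 d2).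
    apply: (mulIf X0n); rewrite divfK //.
    by case: (ord2P j) => ->; rewrite /cross; ring.
  by field.
Qed.

Lemma spans_vertex vs P v : spans_polygon vs P -> v \in vs -> vertices P (toQ v).
Proof. by move=> [_ h] vvs; apply/h; exists v. Qed.

Lemma spans_mem vs P v : spans_polygon vs P -> v \in vs -> P (toQ v).
Proof. by move=> [-> _] /hull_mem. Qed.

Lemma spans_primitive l vs P v : reflexive_polygon l P -> spans_polygon vs P ->
  v \in vs -> primitive v.
Proof. by move=> [_ _ h _] sP vvs; apply: h; exact: spans_vertex vvs. Qed.

Lemma spans_nonempty l vs P : reflexive_polygon l P -> spans_polygon vs P ->
  exists v, v \in vs.
Proof.
move=> [_ oP _ _] [PE _]; have := origin_in oP; rewrite PE.
by case: vs {PE} => [/hull_nil//|v vs] _; exists v; rewrite mem_head.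
Qed.

Lemma supporting_int l P vs g v : supporting l P g -> spans_polygon vs P -> v \in vs ->
  pairing g v <= l%:Z.
Proof.
move=> [_ h] sP /(spans_mem sP)/h.
by rewrite pairing_int natr_intr ler_int.
Qed.

(** By integrality, if no vertex reached l, all vertices and hence all of [P] would stay below l -
    1. *)
Lemma supporting_vertex l P vs g z : supporting l P g -> spans_polygon vs P -> P z ->
  pairing (toQ g) z = l%:R -> exists2 v, v \in vs & pairing g v = l%:Z.
Proof.
move=> sg sP Pz gz; apply: contrapT => h.
have : pairing (toQ g) z <= (l%:Z - 1)%:~R.
  have [PE _] := sP; rewrite PE in Pz; apply: hull_le Pz => v vs1.
  rewrite pairing_int ler_int; have := supporting_int sg sP vs1.
  rewrite le_eqVlt => /orP[/eqP e|]; first by case: h; exists v.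
  by move: (pairing g v) => x; lia.
by rewrite gz natr_intr ler_int; lia.
Qed.

(** Modulo l, two functionals that kill the same primitive vector are proportional: multiply the
    cross product by 1 = <p, v> and expand. *)
Lemma dvd_cross l (u g v : 'rV[int]_2) : primitive v ->
  pairing u v \in dvdz l -> pairing g v \in dvdz l -> cross u g \in dvdz l.
Proof.
move=> /primitiveP[p pv] uv gv.
have -> : cross u g = (p 0 0 * g 0 1 - p 0 1 * g 0 0) * pairing u v
    + (p 0 1 * u 0 0 - p 0 0 * u 0 1) * pairing g v.
  transitivity (pairing p v * cross u g); first by rewrite pv mul1r.
  by rewrite !pairingE /cross; ring.
by rewrite rpredD // dvdz_mull.
Qed.

(** The converse transfer: modulo l, [u] is a multiple of the primitive functional [g], so it
    vanishes wherever [g] does. *)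
Lemma dvd_pairing l (u g v : 'rV[int]_2) : primitive g ->
  cross u g \in dvdz l -> pairing g v \in dvdz l -> pairing u v \in dvdz l.
Proof.
move=> /primitiveP[p pg] ug gv.
have -> : pairing u v = pairing u p * pairing g v + cross v p * cross u g.
  transitivity (pairing p g * pairing u v); first by rewrite pg mul1r.
  by rewrite !pairingE /cross; ring.
by rewrite rpredD // dvdz_mull.
Qed.

(* Divisibility of [<u, v>] by [l] propagates along edges; a vertex violating it with
   maximal [<u, v>] has a neighbour with a larger value, whence a contradiction. *)
Lemma polygon_lattice l P vs : reflexive_polygon l P -> spans_polygon vs P ->
  exists u, primitive u /\ forall v, v \in vs -> pairing u v \in dvdz l%:Z.
Proof.
move=> rP sP; have [v0 v0s] := spans_nonempty rP sP.
have [u [_ [_ [_ [_ _ [su uv0 _ _] _ _]]]]] := vertex_neighbours rP sP v0s.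
have [pu _] := su; exists u; split=> // v vs_v.
apply: contraT => bad.
pose bads := [seq v <- vs | pairing u v \notin dvdz l%:Z].
have vb : v \in bads by rewrite mem_filter bad.
(* Placing an integer in the first coordinate makes the lexicographic maximum an ordinary one. *)
have [|m mb mmax] := @lexle_max _ (fun v => row2 (pairing u v) 0) bads.
  by case: (bads) vb.
move: mb; rewrite mem_filter => /andP[mbad ms].
have max w : w \in vs -> pairing u m < pairing u w -> pairing u w \in dvdz l%:Z.
  move=> ws mw; apply: contraT => wb.
  have /mmax : w \in bads by rewrite mem_filter wb.
  by rewrite /lexle !row2E0 !row2E1; move: mw; move: (pairing u w) (pairing u m) => a b; lia.
have ml : pairing u m < l%:Z.
  rewrite lt_neqAle (supporting_int su sP ms) andbT; apply: contra mbad => /eqP ->.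
  exact: dvdzz.
(* A neighbour with a larger value is good, so [u] and the edge normal [g] are proportional modulo
   l; then [m] would be good as well. *)
have edge g w : w \in vs -> on_edge l P g m w -> pairing u w <= pairing u m.
  move=> ws [[pg _] gm gw _]; rewrite leNgt; apply: contra mbad => mw.
  have ug : cross u g \in dvdz l%:Z.
    apply: (dvd_cross (spans_primitive rP sP ws)); first exact: max.
    by rewrite gw dvdzz.
  by apply: (dvd_pairing pg ug); rewrite gm dvdzz.
have [g1 [w1 [g2 [w2 [w1s w2s oe1 oe2 cone]]]]] := vertex_neighbours rP sP ms.
have le1 := edge _ _ w1s oe1; have le2 := edge _ _ w2s oe2.
(* The vertex [v0], where [u] takes the value l, lies in the tangent cone at [m], yet [u] increases
   towards neither neighbour of [m]. *)
have sub g : supporting l P g -> pairing g m = l%:Z -> pairing (toQ g) (toQ v0 - toQ m) <= 0.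
  move=> sg gm; rewrite pairingBr !pairing_int gm subr_le0 ler_int.
  exact: supporting_int sg sP v0s.
have [s1 e1 _ _] := oe1; have [s2 e2 _ _] := oe2.
have [a [b [a0 b0 e]]] := cone _ (sub _ s1 e1) (sub _ s2 e2).
have Z c (x : 'rV[rat]_2) : pairing (toQ u) (c *: x) = c * pairing (toQ u) x.
  by rewrite !pairingE !mxE; ring.
have := pairingDr (toQ u) (a *: (toQ w1 - toQ m)) (b *: (toQ w2 - toQ m)).
rewrite -e !Z !pairingBr !pairing_int uv0 => h.
have : (0 : rat) < (l%:Z)%:~R - (pairing u m)%:~R by rewrite subr_gt0 ltr_int.
have : a * ((pairing u w1)%:~R - (pairing u m)%:~R) <= 0.
  by rewrite mulr_ge0_le0 // subr_le0 ler_int.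
have : b * ((pairing u w2)%:~R - (pairing u m)%:~R) <= 0.
  by rewrite mulr_ge0_le0 // subr_le0 ler_int.
by rewrite h; lra.
Qed.

(** * Linear images *)

Definition linear_image (T : 'M[rat]_2) (P : set 'rV[rat]_2) : set 'rV[rat]_2 :=
  [set x *m T | x in P]%classic.

Lemma linear_imageE T P x : T \in unitmx -> linear_image T P (x *m T) <-> P x.
Proof.
move=> uT; split=> [[y Py /(congr1 (mulmxr (invmx T)))]|Px]; last by exists x.
by rewrite /= !mulmxK // => <-.
Qed.

Lemma vertices_image T P x : T \in unitmx ->
  vertices (linear_image T P) (x *m T) <-> vertices P x.
Proof.
move=> uT; have inj (a b : 'rV[rat]_2) : a *m T = b *m T -> a = b.
  by move/(congr1 (mulmxr (invmx T))); rewrite /= !mulmxK.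
split=> -[Px ext]; split.
- exact: (linear_imageE _ _ uT).1 Px.
- move=> a b t Pa Pb t01 e.
  have Pa' : linear_image T P (a *m T) by exact/linear_imageE.
  have Pb' : linear_image T P (b *m T) by exact/linear_imageE.
  have e' : x *m T = t *: (a *m T) + (1 - t) *: (b *m T).
    by rewrite e mulmxDl -!scalemxAl.
  by have [/inj -> /inj ->] := ext _ _ t Pa' Pb' t01 e'.
- exact: (linear_imageE _ _ uT).2 Px.
- move=> _ _ t [a Pa <-] [b Pb <-] t01 e.
  have e' : x = t *: a + (1 - t) *: b by apply: inj; rewrite e mulmxDl -!scalemxAl.
  by have [-> ->] := ext a b t Pa Pb t01 e'.
Qed.

Lemma spans_image T P vs vs' : T \in unitmx -> spans_polygon vs P ->
  [seq toQ v | v <- vs'] = [seq toQ v *m T | v <- vs] ->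
  spans_polygon vs' (linear_image T P).
Proof.
move=> uT [PE hv] e.
have to v : v \in vs -> exists2 v', v' \in vs' & toQ v' = toQ v *m T.
  move=> vvs; have : toQ v *m T \in [seq toQ v | v <- vs'] by rewrite e; apply/mapP; exists v.
  by move=> /mapP[v' h ->]; exists v'.
have from v' : v' \in vs' -> exists2 v, v \in vs & toQ v' = toQ v *m T.
  by move=> h; have := map_f toQ h; rewrite e => /mapP[v ? ->]; exists v.
split.
  apply/seteqP; split=> [_ [x Px <-]|].
    rewrite PE in Px; move: x Px; apply: hull_ind.
      by move=> v /to[v' h /= <-]; exact: hull_mem.
    move=> x y t hx hy t01 /=; rewrite mulmxDl -!scalemxAl; exact: hull_convex.
  apply: hull_ind => [v' /from[v vvs ->]|].
    by exists (toQ v) => //; rewrite PE; exact: hull_mem.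
  move=> _ _ t [x Px <-] [y Py <-] t01; exists (t *: x + (1 - t) *: y).
    by rewrite PE in Px Py *; exact: hull_convex.
  by rewrite mulmxDl -!scalemxAl.
move=> z; split=> [vz|[v' /from[v vvs ->] ->]]; last first.
  by apply/vertices_image => //; apply/hv; exists v.
have [[x Px xz] _] := vz; move: vz; rewrite -xz => /vertices_image => /(_ uT)/hv[v vvs xv].
by have [v' v's ev] := to v vvs; exists v' => //; rewrite ev xv.
Qed.

Lemma origin_interior_image T P : T \in unitmx -> origin_interior P ->
  origin_interior (linear_image T P).
Proof.
move=> uT [e e0 h]; set S := invmx T.
(* A bound for the inverse of [T] in the sup norm; the summand 1 makes it positive. *)
pose M := 1 + \sum_(j < 2) (`|S 0 j| + `|S 1 j|).
have Mj j : `|S 0 j| + `|S 1 j| <= M.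
  rewrite /M !big_ord_recl big_ord0 /=.
  have -> : lift ord0 ord0 = 1 :> 'I_2 by apply/val_inj.
  have -> : ord0 = 0 :> 'I_2 by apply/val_inj.
  have := normr_ge0 (S 0 0); have := normr_ge0 (S 0 1).
  have := normr_ge0 (S 1 0); have := normr_ge0 (S 1 1).
  by case: (ord2P j) => ->; lra.
have M0 : 0 < M by have := Mj 0; rewrite /M ltr_pwDl // sumr_ge0 // => i _; rewrite addr_ge0.
exists (e / M); first exact: divr_gt0.
move=> x hx; exists (x *m S); last by rewrite mulmxKV.
apply: h => j; rewrite mulmx2E; apply: le_trans (ler_normD _ _) _; rewrite !normrM.
have h1 : `|x 0 0| * `|S 0 j| <= e / M * `|S 0 j| by rewrite ler_wpM2r.
have h2 : `|x 0 1| * `|S 1 j| <= e / M * `|S 1 j| by rewrite ler_wpM2r.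
have h3 : e / M * (`|S 0 j| + `|S 1 j|) <= e / M * M by rewrite ler_wpM2l ?Mj // ltW // divr_gt0.
rewrite divfK in h3; last exact: lt0r_neq0.
by rewrite mulrDr in h3; lra.
Qed.

(** The displayed proportionality says that [g'] reaches l' exactly where [g] reaches l. It is used
    for the passage to Lambda, from index l to 1, and for unimodular maps with l = l'. *)
Lemma reflexive_image l l' T P vs vs' : (0 < l)%N -> (0 < l')%N -> T \in unitmx ->
  reflexive_polygon l P -> spans_polygon vs P ->
  [seq toQ v | v <- vs'] = [seq toQ v *m T | v <- vs] ->
  (forall v, v \in vs' -> primitive v) ->
  (forall g v, supporting l P g -> v \in vs -> pairing g v = l%:Z ->
    exists2 g', primitive g' &
      forall x, l%:R * pairing (toQ g') (x *m T) = l'%:R * pairing (toQ g) x) ->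
  reflexive_polygon l' (linear_image T P).
Proof.
move=> l0 l0' uT rP sP e pvs hg; have [_ oP _ _] := rP.
have sP' := spans_image uT sP e; have [PE' hv'] := sP'.
split.
- by exists vs'.
- exact: origin_interior_image.
- by move=> v /hv'[w ws /toQ_inj ->]; exact: pvs.
move=> F [[u u0 [c uP FE]] [x0 [y0 [Fx Fy xy0]]]]; move: Fx Fy xy0; rewrite FE.
move=> [[x Px <-] ux] [[y Py <-] uy] xy.
rewrite !pairing_mulmx in ux uy.
have [|||g [sg gE]] := edge_normal rP _ _ Px Py _ ux uy.
- move=> uT0; apply: u0; rewrite -[u](@mulmxK _ _ _ T^T) ?unitmx_tr //.
  by rewrite uT0 mul0mx.
- by move=> z Pz; rewrite -pairing_mulmx; apply: uP; exact/linear_imageE.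
- by move=> xy'; apply: xy; rewrite xy'.
have gx : pairing (toQ g) x = l%:R by apply/gE.
have [v vvs gv] := supporting_vertex sg sP Px gx.
have [g' pg' g'E] := hg g v sg vvs gv.
have lR : (0 : rat) < l%:R by rewrite ltr0n.
have lR' : (0 : rat) < l'%:R by rewrite ltr0n.
have g'P z : P z -> pairing (toQ g') (z *m T) <= l'%:R.
  move=> Pz; rewrite -(ler_pM2l lR) g'E mulrC ler_pM2r //.
  by have [_] := sg; apply.
have g'eq z : P z -> (pairing u (z *m T) = c <-> pairing (toQ g') (z *m T) = l'%:R).
  move=> Pz; rewrite pairing_mulmx gE //; split=> h.
    by apply: (mulfI (lt0r_neq0 lR)); rewrite g'E h mulrC.
  by apply: (mulfI (lt0r_neq0 lR')); rewrite -g'E h mulrC.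
have FE' : [set z | linear_image T P z /\ pairing u z = c]%classic =
    [set z | linear_image T P z /\ pairing (toQ g') z = l'%:R]%classic.
  by apply/seteqP; split=> _ [[z Pz <-] hz]; (split; first by exists z); apply/(g'eq z Pz).
split=> //; exists g'; last exact: FE'.
split=> //; exists l'%:R; last exact: FE'.
by move=> _ [z Pz <-]; exact: g'P.
Qed.

Lemma tr_map_intr (U : 'M[int]_2) : (map_mx intr U)^T = map_mx intr U^T :> 'M[rat]_2.
Proof. by apply/matrixP=> i j; rewrite !mxE. Qed.

Lemma reflexive_image_unit l P vs U : (0 < l)%N -> U \in unitmx ->
  reflexive_polygon l P -> spans_polygon vs P ->
  reflexive_polygon l (linear_image (map_mx intr U) P) /\
  spans_polygon [seq v *m U | v <- vs] (linear_image (map_mx intr U) P).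
Proof.
move=> l0 uU rP sP; have uUQ := unit_map_intr (unit_det_neq0 uU).
have e : [seq toQ v | v <- [seq v *m U | v <- vs]] =
    [seq toQ v *m map_mx intr U | v <- vs].
  by rewrite -map_comp; apply/eq_in_map => v _ /=; rewrite toQ_mulmx.
split; last exact: spans_image e.
apply: (reflexive_image l0 l0 uUQ rP sP e).
  move=> _ /mapP[v vvs ->]; apply: primitive_unit => //.
  exact: spans_primitive rP sP vvs.
move=> g v [pg _] _ _; exists (g *m invmx U^T).
  by apply: primitive_unit; rewrite // unitmx_inv unitmx_tr.
by move=> x; rewrite pairing_mulmx tr_map_intr -toQ_mulmx mulmxKV ?unitmx_tr.
Qed.

(* Were [b] nonzero, some edge normal [g] of [Q] would satisfy [<g, b> >= 1], forcing [g] to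
   be nonpositive on a neighbourhood of the origin. *)
Lemma reflexive_iso_linear Q0 Q U b : reflexive_polygon 1 Q0 -> reflexive_polygon 1 Q ->
  U \in unitmx ->
  [set x *m map_mx intr U + toQ b | x in vertices Q0]%classic = vertices Q -> b = 0.
Proof.
move=> rQ0 rQ uU e; have [lQ0 oQ0 _ _] := rQ0; have [lQ _ _ _] := rQ.
have [vs0 sP0] := polygon_vertices lQ0; have [vs sP] := polygon_vertices lQ.
apply: contrapT => b0.
have [v0 v0s] := spans_nonempty rQ sP.
have [|v vvs vmax] := @lexle_max _ (fun v => row2 (pairing b v) 0) vs.
  by case: (vs) v0s.
have {}vmax w : w \in vs -> pairing b w <= pairing b v.
  move=> /vmax; rewrite /lexle !row2E0 !row2E1.
  by move: (pairing b w) (pairing b v) => x y; lia.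
have [g1 [w1 [g2 [w2 [w1s w2s [s1 _ _ _] [s2 _ _ _] cone]]]]] := vertex_neighbours rQ sP vvs.
(* If neither normal at the vertex [v] that maximises <b, .> were positive on [b], then [b] would
   lie in the tangent cone at [v], and <b, b> <= 0 by maximality. *)
have [g sg gb] : exists2 g, supporting 1 Q g & 0 < pairing g b.
  case: (ltrP 0 (pairing g1 b)) => h1; first by exists g1.
  case: (ltrP 0 (pairing g2 b)) => h2; first by exists g2.
  have [|| x [y [x0 y0 bE]]] := cone (toQ b).
  - by rewrite pairing_int lerz0.
  - by rewrite pairing_int lerz0.
  have Z (c : rat) (z : 'rV[rat]_2) : pairing (toQ b) (c *: z) = c * pairing (toQ b) z.
    by rewrite !pairingE !mxE; ring.
  have := pairingDr (toQ b) (x *: (toQ w1 - toQ v)) (y *: (toQ w2 - toQ v)).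
  rewrite -bE !Z !pairingBr !pairing_int => h.
  have bb : 0 < pairing b b.
    rewrite pairingE -!expr2 lt_neqAle addr_ge0 ?sqr_ge0 // andbT eq_sym paddr_eq0 ?sqr_ge0 //.
    rewrite !sqrf_eq0; apply/negP => /andP[/eqP z0 /eqP z1].
    by apply: b0; apply: rv2P; rewrite mxE.
  have : x * ((pairing b w1)%:~R - (pairing b v)%:~R) <= 0.
    by rewrite mulr_ge0_le0 // subr_le0 ler_int; exact: vmax.
  have : y * ((pairing b w2)%:~R - (pairing b v)%:~R) <= 0.
    by rewrite mulr_ge0_le0 // subr_le0 ler_int; exact: vmax.
  have : (0 : rat) < (pairing b b)%:~R by rewrite ltr0z.
  by rewrite h; lra.
have [pg gQ] := sg.
have gU : toQ (g *m U^T) = 0.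
  apply: (origin_interior_functional oQ0); have [-> _] := sP0.
  apply: hull_le => w ws.
  have : vertices Q (toQ w *m map_mx intr U + toQ b).
    by rewrite -e; exists (toQ w) => //; exact: spans_vertex sP0 ws.
  case=> /gQ + _; rewrite pairingDr -toQ_mulmx !pairing_int pairing_mulmx.
  move: gb; move: (pairing g b) (pairing (g *m U^T) w) => p q gb.
  by rewrite -rmorphD natr_intr ler_int lerz0; lia.
apply: (primitive_toQ (primitive_unit (U := U^T) _ pg) gU).
by rewrite unitmx_tr.
Qed.

(** * The polygon case *)

(** Any vertex [v] with the normal [g] of an edge at [v] will do. The functional (0,1) is then
    extreme in the dual because it is tight at the two ends of that edge. *)
Lemma polygon_normalization Q : reflexive_polygon 1 Q ->
  exists Q', [/\ reflexive_polygon 1 Q', polygon_iso Q Q' & normalized_polygon Q'].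
Proof.
move=> rQ; have [lQ _ _ _] := rQ; have [vs sP] := polygon_vertices lQ.
have [v vvs] := spans_nonempty rQ sP.
have [g [w [_ [_ [ws _ [[pg gQ] gv gw wv] _ _]]]]] := vertex_neighbours rQ sP vvs.
have [U uU [vU UT]] := exists_dual_basis gv.
have uUQ := unit_map_intr (unit_det_neq0 uU).
have [rQ' sP'] := reflexive_image_unit (ltn0Sn 0) uU rQ sP.
set Q' := linear_image _ _ in rQ' sP'.
have vs' : row2 0 1 \in [seq v *m U | v <- vs] by rewrite -vU; apply/mapP; exists v.
exists Q'; split=> //.
  exists U, 0; split=> //; apply/seteqP; split=> [_ [x vx <-]|z vz].
    have -> : toQ 0 = 0 by apply/rowP=> j; rewrite !mxE.
    by rewrite addr0; exact/vertices_image.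
  have [[x Qx xz] _] := vz; exists x; first by apply/(vertices_image _ _ uUQ); rewrite xz.
  have -> : toQ 0 = 0 by apply/rowP=> j; rewrite !mxE.
  by rewrite addr0.
split; first exact: spans_vertex sP' vs'.
have e2 x : pairing (toQ (row2 0 1)) (x *m map_mx intr U) = pairing (toQ g) x.
  by rewrite pairing_mulmx tr_map_intr -toQ_mulmx UT.
split; first by move=> _ [x Qx <-]; rewrite e2; exact: gQ.
(* Two distinct points at height 1 of [g] are linearly independent, so the values at them determine
   a functional. *)
have c0 : cross (toQ v *m map_mx intr U) (toQ w *m map_mx intr U) != 0.
  rewrite cross_mulmx; apply: mulf_neq0; last by rewrite det_map_mx intr_eq0 unit_det_neq0.
  apply/eqP => c0; apply: wv; apply: toQ_inj.
  have gvQ : pairing (toQ g) (toQ v) = 1 by rewrite pairing_int gv.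
  have gwQ : pairing (toQ g) (toQ w) = 1 by rewrite pairing_int gw.
  apply: rv2P.
    transitivity (toQ w 0 0 * pairing (toQ g) (toQ v)); first by rewrite gvQ mulr1.
    transitivity (toQ v 0 0 * pairing (toQ g) (toQ w) - toQ g 0 1 * cross (toQ v) (toQ w)).
      by rewrite !pairingE /cross; ring.
    by rewrite c0 gwQ mulr1 mulr0 subr0.
  transitivity (toQ w 0 1 * pairing (toQ g) (toQ v)); first by rewrite gvQ mulr1.
  transitivity (toQ v 0 1 * pairing (toQ g) (toQ w) + toQ g 0 0 * cross (toQ v) (toQ w)).
    by rewrite !pairingE /cross; ring.
  by rewrite c0 gwQ mulr1 mulr0 addr0.
move=> x y t hx hy /andP[t0 t1] xyE.
(* A proper average of two numbers that are at most 1 equals 1 only if both do. *)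
have tight z : vertices Q z -> pairing (toQ g) z = 1 ->
    pairing x (z *m map_mx intr U) = 1 /\ pairing y (z *m map_mx intr U) = 1.
  move=> [Qz _] gz; have Q'z : Q' (z *m map_mx intr U) by exists z.
  have := hx _ Q'z; have := hy _ Q'z; have := e2 z; rewrite xyE gz.
  set a := z *m _.
  have -> : pairing (t *: x + (1 - t) *: y) a = t * pairing x a + (1 - t) * pairing y a.
    by rewrite !pairingE !mxE; ring.
  set p := pairing x a; set q := pairing y a => h q1 p1.
  have t1' : 0 < 1 - t by lra.
  have a1 : t * p <= t by rewrite -[X in _ <= X]mulr1 ler_pM2l.
  have a2 : (1 - t) * q <= 1 - t by rewrite -[X in _ <= X]mulr1 ler_pM2l.
  by split; [apply: (mulfI (lt0r_neq0 t0))|apply: (mulfI (lt0r_neq0 t1'))]; rewrite mulr1; lra.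
have [xv yv] := tight _ (spans_vertex sP vvs) (etrans (pairing_int _ _) (congr1 _ gv)).
have [xw yw] := tight _ (spans_vertex sP ws) (etrans (pairing_int _ _) (congr1 _ gw)).
have sub (z a : 'rV[rat]_2) : pairing z a = 1 -> pairing (toQ (row2 0 1)) a = 1 ->
    pairing (z - toQ (row2 0 1)) a = 0.
  by move=> h1 h2; rewrite pairingC pairingBr !(pairingC a) h1 h2 subrr.
have ev := etrans (e2 (toQ v)) (etrans (pairing_int _ _) (congr1 intr gv)).
have ew := etrans (e2 (toQ w)) (etrans (pairing_int _ _) (congr1 intr gw)).
split; apply/eqP; rewrite -subr_eq0; apply/eqP;
  by apply: (cross_pairing_eq0 c0); apply: sub.
Qed.

(* Otherwise all vertices on which [y] takes the value 1 coincide, and [y] can be moved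
   in both directions along a line inside the dual. *)
Lemma dual_vertex_tight l Q vs (y : 'rV[int]_2) : reflexive_polygon l Q ->
  spans_polygon vs Q -> vertices (dual_polygon Q) (toQ y) ->
  exists a b, [/\ a \in vs, b \in vs, a <> b, pairing y a = 1 & pairing y b = 1].
Proof.
move=> rQ sP [dy ext]; apply: contrapT => h.
have [d d0 dv] : exists2 d : 'rV[rat]_2, d <> 0 &
    forall v, v \in vs -> pairing y v = 1 -> pairing d (toQ v) = 0.
  case: (pselect (exists2 v, v \in vs & pairing y v = 1)) => [[v vvs yv]|nv].
    exists (perp (toQ v)).
      move=> /rowP p0; have := p0 0; have := p0 1; rewrite row2E0 row2E1 !mxE => /eqP.
      rewrite oppr_eq0 !intr_eq0 => /eqP v0 /eqP; rewrite intr_eq0 => /eqP v1.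
      by move: yv; rewrite pairingE v0 v1 !mulr0.
    move=> w ws yw; have [->|/eqP wv] := eqVneq w v; first by rewrite pairing_perp1 crossxx.
    by case: h; exists w, v.
  exists (row2 1 0); first by move/rowP/(_ 0); rewrite row2E0 mxE; lra.
  by move=> v vvs yv; case: nv; exists v.
have [M M0 hM] : exists2 M : rat, 0 < M & forall v, v \in vs -> `|pairing d (toQ v)| <= M.
  elim: (vs) => [|v s [M M0 IH]]; first by exists 1.
  exists (M + `|pairing d (toQ v)|); first by rewrite ltr_pwDl.
  move=> w; rewrite inE => /orP[/eqP->|/IH hw]; first by rewrite ler_wpDl // ltW.
  by rewrite ler_wpDr.
have yd (c : rat) : `|c| = 1 -> dual_polygon Q (toQ y + (c / M) *: d).
  move=> c1 z; have [-> _] := sP; move: z; apply: hull_le => v vvs.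
  have -> : pairing (toQ y + (c / M) *: d) (toQ v) = (pairing y v)%:~R + (c / M) * pairing d (toQ v).
    by rewrite -pairing_int !pairingE !mxE; ring.
  have [yv|yv] := eqVneq (pairing y v) 1; first by rewrite (dv v) // yv mulr0 addr0.
  have yv1 : pairing y v <= 1.
    have := dy _ (spans_mem sP vvs); rewrite pairing_int -[X in _ <= X]/(1%:~R) ler_int //.
  (* Here integrality of [y] matters: a constraint that is not tight has slack at least 1, so moving
     by d/M stays inside the dual. *)
  have {yv yv1}yv0 : pairing y v <= 0 by move: yv yv1; move: (pairing y v) => x; lia.
  have yv0' : (pairing y v)%:~R <= 0 :> rat by rewrite lerz0.
  have : (c / M) * pairing d (toQ v) <= 1.
    apply: le_trans (ler_norm _) _; rewrite !normrM c1 mul1r normfV (gtr0_norm M0).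
    by rewrite mulrC ler_pdivrMr // mul1r hM.
  lra.
have dm : dual_polygon Q (toQ y + (- 1 / M) *: d) by apply: yd; rewrite normrN normr1.
have dp : dual_polygon Q (toQ y + (1 / M) *: d) by apply: yd; rewrite normr1.
have [||/eqP + _] := ext _ _ 2%:R^-1 dp dm; first by lra.
  apply/rowP=> j; rewrite !mxE; have Mn := lt0r_neq0 M0; by field.
rewrite -subr_eq0 addrC addKr scaler_eq0 => /orP[|/eqP//].
by rewrite mul1r invr_eq0 (gt_eqF M0).
Qed.

Lemma lin2E (T : pzRingType) (a b : T) (x y : 'rV[T]_2) j :
  (a *: x + b *: y) 0 j = a * x 0 j + b * y 0 j.
Proof. by rewrite !mxE. Qed.

Lemma polygon_classification R : representatives (reflexive_polygon 1) polygon_iso R ->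
  (forall Q, R Q -> normalized_polygon Q) ->
  forall l P, (2 <= l)%N -> reflexive_polygon l P ->
  exists Q, R Q /\ exists i : nat, [/\ (0 < i < l)%N, coprime i l
    & polygon_iso P (polygon_image (mx22 l%:Z i%:Z 0 1) Q)].
Proof.
move=> [RC repR _] nR l P l2 rP; have [lP _ _ _] := rP.
have l0 : (0 < l)%N by lia.
have lz : l%:Z != 0 by rewrite eqz_nat -lt0n.
have [vs sP] := polygon_vertices lP.
have [u [pu uvs]] := polygon_lattice rP sP.
have [p pup] : exists p, pairing u p = 1.
  by have [q qu] := (primitiveP u).1 pu; exists q; rewrite pairingC.
(* A basis of Lambda: [perp u] lies in the kernel of [u], and <u, p> = 1. *)
pose B := rows2 (perp u) (l%:Z *: p).
have BE x : x *m B = x 0 0 *: perp u + (x 0 1 * l%:Z) *: p.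
  by apply: rv2P; rewrite mulmx2E !mxE /=; ring.
have dB : \det B = l%:Z.
  rewrite det_rows2; transitivity (l%:Z * pairing u p); last by rewrite pup mulr1.
  by rewrite /cross row2E0 row2E1 !mxE pairingE; ring.
have [qs vsE] : exists qs, vs = [seq q *m B | q <- qs].
  apply: seq_preim => v vvs.
  (* From <u, p> = 1 one has v = (cross v p) perp u + <u, v> p, and the last coefficient is
     divisible by l. *)
  exists (row2 (cross v p) (pairing u v %/ l%:Z)%Z); rewrite BE row2E0 row2E1.
  rewrite divzK; last exact: uvs.
  apply: rv2P; rewrite lin2E ?row2E0 ?row2E1.
    transitivity (pairing u p * v 0 0); first by rewrite pup mul1r.
    by rewrite !pairingE /cross; ring.
  transitivity (pairing u p * v 0 1); first by rewrite pup mul1r.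
  by rewrite !pairingE /cross; ring.
have uBQ : (map_mx intr B : 'M[rat]_2) \in unitmx by apply: unit_map_intr; rewrite dB.
pose T := invmx (map_mx intr B : 'M[rat]_2).
have uT : T \in unitmx by rewrite unitmx_inv.
have TB q : toQ (q *m B) *m T = toQ q by rewrite toQ_mulmx mulmxK.
have qsT : [seq toQ q | q <- qs] = [seq toQ v *m T | v <- vs].
  by rewrite vsE -map_comp; apply/eq_in_map => q _ /=; rewrite TB.
have sQ0 := spans_image uT sP qsT.
have rQ0 : reflexive_polygon 1 (linear_image T P).
  apply: (reflexive_image l0 _ uT rP sP qsT) => //.
    move=> q qqs; apply: (primitive_mulmx (B := B)); apply: (spans_primitive rP sP).
    by rewrite vsE; apply: map_f.
  move=> g v [pg gP] vvs gv.
  have ug : cross g u \in dvdz l%:Z.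
    apply: (dvd_cross (spans_primitive rP sP vvs)); last exact: uvs.
    by rewrite gv dvdzz.
  (* The functional g/l in coordinates of Lambda, that is, its values on the rows of [B]. It is
     integral because [g] and [u] are proportional modulo l, and primitive because it takes the
     value 1 at a preimage of [v]. *)
  pose g' := row2 (cross g u %/ l%:Z)%Z (pairing g p).
  have g'E q : l%:Z * pairing g' q = pairing g (q *m B).
    transitivity ((cross g u %/ l%:Z)%Z * l%:Z * q 0 0 + pairing g p * l%:Z * q 0 1).
      by rewrite [X in _ * X]pairingE row2E0 row2E1; ring.
    by rewrite divzK // BE !pairingE !lin2E !row2E0 !row2E1 /cross; ring.
  exists g'.
    move: vvs; rewrite vsE => /mapP[q _ vE]; apply/primitiveP; exists q.
    apply: (mulfI lz); rewrite pairingC g'E -vE gv mulr1.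
    done.
  move=> x; rewrite mul1r -[x in RHS](mulmxKV uBQ) -/T.
  move: (x *m T) => z.
  rewrite [in RHS]pairing_mulmx tr_map_intr -toQ_mulmx.
  have gB : g *m B^T = l%:Z *: g'.
    have h0 := g'E (row2 1 0); have h1 := g'E (row2 0 1).
    rewrite !pairing_mulmx ![pairing _ (row2 _ _)]pairingE in h0 h1.
    rewrite [row2 1 0 _ _]row2E0 [row2 1 0 _ _]row2E1 !mulr1 !mulr0 !addr0 in h0.
    rewrite [row2 0 1 _ _]row2E0 [row2 0 1 _ _]row2E1 !mulr1 !mulr0 !add0r in h1.
    by apply: rv2P; rewrite [RHS]mxE.
  by rewrite gB !pairingE !mxE !rmorphM natr_intr /=; ring.
have [Q RQ [U [b [uU e]]]] := repR _ rQ0.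
have rQ := RC Q RQ; have [lQ _ _ _] := rQ.
have b0 := reflexive_iso_linear rQ0 rQ uU e; subst b.
have toQ0 : toQ 0 = 0 by apply/rowP=> j; rewrite !mxE.
have [vsQ sQ] := polygon_vertices lQ.
pose C := invmx U *m B.
have CE q : q *m U *m C = q *m B by rewrite /C mulmxA mulmxK.
have vQ q : q \in qs -> q *m U \in vsQ.
  move=> qqs; have [_ hQ] := sQ.
  have /hQ[a aQ /toQ_inj -> //] : vertices Q (toQ (q *m U)).
  rewrite -e; exists (toQ q); first exact: spans_vertex sQ0 qqs.
  by rewrite toQ0 addr0 toQ_mulmx.
have Qv a : a \in vsQ -> exists2 q, q \in qs & a = q *m U.
  move=> aQ; have := spans_vertex sQ aQ; rewrite -e => -[x vx].
  have [_ h] := sQ0; have [q qqs ->] := (h x).1 vx.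
  by rewrite toQ0 addr0 -toQ_mulmx => /toQ_inj <-; exists q.
have aC a : a \in vsQ -> a *m C \in vs.
  by move=> /Qv[q qqs ->]; rewrite CE vsE; apply/mapP; exists q.
have dC : `|\det C|%N = l by rewrite det_mulmx abszM unit_det ?unitmx_inv // mul1n dB.
have [vN dN] := nR Q RQ.
have [_ hQ] := sQ; have [a aQ /toQ_inj aE] := (hQ _).1 vN.
have pC : primitive (row2 0 1 *m C) by apply: (spans_primitive rP sP); rewrite aE aC.
have [V [i [uV il CV]]] := hermite_normal_form l0 dC pC.
set A := mx22 l%:Z i%:Z 0 1 in CV *.
have dA : \det A = l%:Z by rewrite det22 /A !mx22E; ring.
have cil : coprime i l.
  have [c [d [cQ dQ cd yc yd]]] := dual_vertex_tight rQ sQ dN.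
  have dC0 : \det C != 0 by rewrite -absz_gt0 dC.
  have uCQ := unit_map_intr dC0.
  (* The functional (0,1) of [Q], transported to [P] by the inverse of [C]. It attains its maximum 1
     at the images of [c] and [d], so it cuts out an edge of [P]. *)
  pose y := toQ (row2 0 1) *m (invmx (map_mx intr C : 'M[rat]_2))^T.
  have yE x : pairing y (toQ (x *m C)) = pairing (toQ (row2 0 1)) (toQ x).
    by rewrite /y -pairing_mulmx toQ_mulmx mulmxK.
  have y0 : y <> 0.
    move=> y0; have := yE c; rewrite y0 pairing_int yc pairingE !mxE !mul0r addr0 => h.
    by have : (0 : rat) = 1 by [].
  have yP z : P z -> pairing y z <= 1.
    have [PE _] := sP; move: z; rewrite PE; apply: hull_le => v vvs.
    move: vvs; rewrite vsE => /mapP[q qqs ->]; rewrite -CE yE.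
    by have [dy _] := dN; apply: dy; exact: spans_mem sQ (vQ q qqs).
  have cd' : toQ (c *m C) <> toQ (d *m C) by move/toQ_inj/(mulmx_inj dC0).
  have yc' : pairing y (toQ (c *m C)) = 1 by rewrite yE pairing_int yc.
  have yd' : pairing y (toQ (d *m C)) = 1 by rewrite yE pairing_int yd.
  have [g [[pg _] gE]] := edge_normal rP y0 yP (spans_mem sP (aC c cQ))
    (spans_mem sP (aC d dQ)) cd' yc' yd'.
  have gint x : x \in vsQ -> pairing (row2 0 1) x = 1 -> pairing g (x *m C) = l%:Z.
    move=> xQ yx; have := (gE _ (spans_mem sP (aC x xQ))).1.
    by rewrite yE pairing_int yx => /(_ erefl); rewrite pairing_int natr_intr => /intr_inj.
  have gc := gint c cQ yc; have gd := gint d dQ yd.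
  pose g' := g *m invmx V^T.
  have uVt : V^T \in unitmx by rewrite unitmx_tr.
  have pg' : primitive g' by apply: primitive_unit; rewrite ?unitmx_inv.
  have g'E x : pairing g' (x *m A) = pairing g (x *m C).
    by rewrite -CV mulmxA pairing_mulmx /g' mulmxKV.
  clearbody g'.
  move: gc gd yc yd; rewrite -!g'E !pairingE !mulmx2E /A !mx22E row2E0 row2E1.
  rewrite !mul0r !add0r !mul1r => gc gd yc yd; rewrite yc yd in gc gd.
  have cd0 : c 0 0 - d 0 0 != 0.
    rewrite subr_eq0; apply/eqP => cd0; apply: cd; apply: rv2P => //.
    by rewrite yc yd.
  (* The transported normal takes the value l at the images of both [c] and [d], so it vanishes on
     their difference, a nonzero multiple of (l,i). Evaluation at [c] then leaves only (-i,l). *)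
  have g0 : g' 0 0 * l%:Z + g' 0 1 * i%:Z = 0.
    apply: (mulIf cd0); rewrite mul0r.
    have sub0 (a1 a2 a3 : int) : a1 = a3 -> a2 = a3 -> a1 - a2 = 0.
      by move=> -> ->; rewrite subrr.
    by rewrite -(sub0 _ _ _ gc gd); ring.
  have g1 : g' 0 1 = l%:Z.
    transitivity (g' 0 1 + (g' 0 0 * l%:Z + g' 0 1 * i%:Z) * c 0 0).
      by rewrite g0 mul0r addr0.
    by rewrite -[RHS]gc; ring.
  have g2 : g' 0 0 = - i%:Z.
    apply: (mulIf lz); apply/eqP; rewrite -subr_eq0; apply/eqP; rewrite -[RHS]g0 g1; ring.
  by move/primitive_coprime: pg'; rewrite g1 g2 abszN /= /coprime => ->.
exists Q; split=> //; exists i; split=> //.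
  rewrite il andbT lt0n; apply/eqP => i0; move: cil; rewrite i0 /coprime gcd0n; lia.
have uAQ : (map_mx intr A : 'M[rat]_2) \in unitmx by apply: unit_map_intr; rewrite dA.
exists V, 0; split=> //.
have qV q : toQ (q *m B) *m map_mx intr V + toQ 0 = toQ (q *m U) *m map_mx intr A.
  by rewrite toQ0 addr0 -!toQ_mulmx -CE -CV !mulmxA.
have [_ hP] := sP; apply/seteqP; split=> [_ [x /hP[v vvs ->] <-]|z vz].
  move: vvs; rewrite vsE => /mapP[q qqs ->]; rewrite qV.
  by apply/vertices_image => //; exact: spans_vertex sQ (vQ q qqs).
have [[x Qx xz] _] := vz; move: vz; rewrite -xz => /(vertices_image _ _ uAQ)/hQ[c cQ ->].
have [q qqs ->] := Qv c cQ.
exists (toQ (q *m B)); last exact: qV.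
by apply/hP; exists (q *m B) => //; rewrite vsE; apply/mapP; exists q.
Qed.

Theorem corollary2p5 :
  ((forall Q : set 'rV[rat]_2, reflexive_polygon 1 Q ->
      exists Q' : set 'rV[rat]_2,
        [/\ reflexive_polygon 1 Q', polygon_iso Q Q' & normalized_polygon Q'])
   /\
   (forall R : set (set 'rV[rat]_2),
      representatives (reflexive_polygon 1) polygon_iso R ->
      (forall Q, R Q -> normalized_polygon Q) ->
      forall (l : nat) (P : set 'rV[rat]_2),
        (2 <= l)%N -> reflexive_polygon l P ->
        exists Q : set 'rV[rat]_2, R Q /\
          exists i : nat, [/\ (0 < i < l)%N, coprime i l
            & polygon_iso P (polygon_image (mx22 l%:Z i%:Z 0 1) Q)]))
  /\
  ((forall Q : seq 'rV[int]_2, reflexive_loop 1 Q ->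
      exists Q' : seq 'rV[int]_2,
        [/\ reflexive_loop 1 Q', loop_iso Q Q' & normalized_loop Q'])
   /\
   (forall R : set (seq 'rV[int]_2),
      representatives (reflexive_loop 1) loop_iso R ->
      (forall Q, R Q -> normalized_loop Q) ->
      forall (l : nat) (P : seq 'rV[int]_2),
        (2 <= l)%N -> reflexive_loop l P ->
        exists Q : seq 'rV[int]_2, R Q /\
          exists i : nat, [/\ (0 < i < l)%N, coprime i l
            & loop_iso P (loop_image (mx22 l%:Z i%:Z 0 1) Q)])).
Proof.
split; split.
- exact: polygon_normalization.
- exact: polygon_classification.
- exact: loop_normalization.
- exact: loop_classification.
Qed.
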